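(* Let $E$ and $F$ be Dedekind complete Riesz spaces with weak order units $e$ and $f$ respectively. (a) If $p\in C_E(e)$ and $q\in C_F(f)$, then $p\otimes q\in C_{\overline{E\overline{\otimes}F}^{\delta}}(e\otimes f)$. (b) If $u\in C_{\overline{E\overline{\otimes}F}^{\delta}}(e\otimes f)$, then $$u=\sup\{p\otimes q : p\in C_E(e),\ q\in C_F(f),\ p\otimes q\le u\},$$ the supremum taken in $\overline{E\overline{\otimes}F}^{\delta}$.
   Context: For a Riesz space $G$ with weak order unit $w$, a component of $w$ is an element $p$ with $0\le p\le w$ and $(w-p)\wedge p=0$; $C_G(w)$ denotes the set of components of $w$ in $G$. $\overline{E\overline{\otimes}F}^{\delta}$ denotes the Dedekind completion of the Fremlin tensor product $E\overline{\otimes}F$ of $E$ and $F$ (ordered by the cone generated by $E_+\otimes F_+$); $e\otimes f$ is a weak order unit of it. *)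

(* Defs.v *)
From HB Require Import structures.
From mathcomp Require Import all_boot all_order all_algebra.
From mathcomp Require Import reals.
Set Implicit Arguments. Unset Strict Implicit. Unset Printing Implicit Defensive.
Import Order.TTheory GRing.Theory Num.Theory.
Local Open Scope ring_scope.

Section Order.
Variables (V : Type) (le : V -> V -> Prop).
Definition upper_bound (S : V -> Prop) (x : V) := forall y, S y -> le y x.
Definition lower_bound (S : V -> Prop) (x : V) := forall y, S y -> le x y.
Definition is_sup (S : V -> Prop) (x : V) :=
  upper_bound S x /\ forall z, upper_bound S z -> le x z.
Definition is_inf (S : V -> Prop) (x : V) :=
  lower_bound S x /\ forall z, lower_bound S z -> le z x.
Definition pair2 (x y : V) : V -> Prop := fun z => z = x \/ z = y.
Definition is_meet (x y m : V) := is_inf (pair2 x y) m.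
End Order.

Record RieszSpace (R : realType) := {
  rs_car :> lmodType R;
  rs_le : rs_car -> rs_car -> Prop;
  rs_refl : forall x, rs_le x x;
  rs_antisym : forall x y, rs_le x y -> rs_le y x -> x = y;
  rs_trans : forall x y z, rs_le x y -> rs_le y z -> rs_le x z;
  rs_add : forall x y z, rs_le x y -> rs_le (x + z) (y + z);
  rs_scale : forall (a : R) x y, 0 <= a -> rs_le x y -> rs_le (a *: x) (a *: y);
  rs_lattice : forall x y : rs_car, exists s, is_sup rs_le (pair2 x y) s
}.

Section Riesz.
Variable R : realType.

Definition dedekind_complete (E : RieszSpace R) : Prop :=
  forall S : E -> Prop, (exists x, S x) -> (exists b, upper_bound (@rs_le R E) S b) ->
  exists s, is_sup (@rs_le R E) S s.

Definition archimedean (E : RieszSpace R) : Prop :=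
  forall x y : E, rs_le 0 x -> (forall n : nat, rs_le (x *+ n) y) -> x = 0.

Definition weak_unit (E : RieszSpace R) (w : E) : Prop :=
  rs_le 0 w /\ forall x : E, rs_le 0 x -> is_meet (@rs_le R E) x w 0 -> x = 0.

Definition component (E : RieszSpace R) (w p : E) : Prop :=
  rs_le 0 p /\ rs_le p w /\ is_meet (@rs_le R E) (w - p) p 0.

Definition riesz_hom (E G : RieszSpace R) (T : E -> G) : Prop :=
  (forall x y, T (x + y) = T x + T y) /\
  (forall (a : R) x, T (a *: x) = a *: T x) /\
  (forall x y m, is_meet (@rs_le R E) x y m -> is_meet (@rs_le R G) (T x) (T y) (T m)).

Definition riesz_bimorphism (E F G : RieszSpace R) (phi : E -> F -> G) : Prop :=
  (forall x : E, rs_le 0 x -> riesz_hom (phi x)) /\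
  (forall y : F, rs_le 0 y -> riesz_hom (fun x => phi x y)) /\
  (forall x : E, (forall y1 y2, phi x (y1 + y2) = phi x y1 + phi x y2) /\
                 (forall (a : R) y, phi x (a *: y) = a *: phi x y)) /\
  (forall y : F, (forall x1 x2, phi (x1 + x2) y = phi x1 y + phi x2 y) /\
                 (forall (a : R) x, phi (a *: x) y = a *: phi x y)).

Definition is_fremlin_tensor (E F H : RieszSpace R) (tp : E -> F -> H) : Prop :=
  archimedean H /\ riesz_bimorphism tp /\
  forall (G : RieszSpace R) (phi : E -> F -> G),
    archimedean G -> riesz_bimorphism phi ->
    exists T : H -> G, riesz_hom T /\ (forall x y, T (tp x y) = phi x y) /\
      forall T' : H -> G, riesz_hom T' -> (forall x y, T' (tp x y) = phi x y) ->
        forall z, T' z = T z.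

Definition is_dedekind_completion (H G : RieszSpace R) (j : H -> G) : Prop :=
  dedekind_complete G /\ riesz_hom j /\ injective j /\
  forall g : G,
    is_sup (@rs_le R G) (fun z => exists h, z = j h /\ rs_le (j h) g) g /\
    is_inf (@rs_le R G) (fun z => exists h, z = j h /\ rs_le g (j h)) g.
End Riesz.

(* Main.v *)
Require Import Defs.
From HB Require Import structures.
From mathcomp Require Import all_boot all_order all_algebra.
From mathcomp Require Import reals.
From mathcomp Require Import generic_quotient ring_quotient.
From mathcomp Require Import boolp classical_sets functions.
From mathcomp Require Import ring lra.
Set Implicit Arguments. Unset Strict Implicit. Unset Printing Implicit Defensive.
Import Order.TTheory GRing.Theory Num.Theory.
Local Open Scope ring_scope.

(* Part (a) only uses that the tensor map is a Riesz bimorphism.  For (b), if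
   [u] is not the supremum, the gap [u - s] to a smaller upper bound dominates
   a positive multiple of some nonzero [p (x) q]; then [p (x) q] is a component
   below [u], hence below [s], hence disjoint from [u - s], hence zero.

   Two facts about the Fremlin tensor product [H] are derived from its
   universal property.
   - Density: every [h > 0] dominates some [d (p (x) q) <> 0].  By uniqueness,
     [H] is generated by the elementary tensors, so [h] lies in the Riesz
     subspace generated by the [x (x) y] with [|x| <= a] and [|y| <= b].  Such
     an [h] is within [d (a (x) b)] of a constant multiple of [a (x) b] on each
     cell [p (x) q] of a finite grid covering [a (x) b]; if all these constants
     were small then [h] would be 0, as [H] is Archimedean.
   - Nonvanishing: [x (x) y <> 0] for [x, y > 0].  Elements of [E] are
     represented by locally bounded real functions on the poset of positive
     nonzero elements, [x p] being the value of [x / e] near [p], up to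
     functions that are arbitrarily small on dense lower sets.  The pointwise
     product is a bimorphism into an Archimedean Riesz space of functions on
     pairs [(p, q)], and it does not vanish at [(x, y)]. *)

Local Notation "x <=: y" := (rs_le x y) (at level 70, no associativity).

(** * Riesz spaces *)

Section RieszTheory.
Variables (R : realType) (V : RieszSpace R).
Implicit Types (x y z u v w m : V) (a b c : R).

Lemma rle_refl x : x <=: x. Proof. exact: rs_refl. Qed.
Hint Resolve rle_refl : core.

Lemma rle_trans y x z : x <=: y -> y <=: z -> x <=: z.
Proof. exact: rs_trans. Qed.

Lemma rleD x y u v : x <=: y -> u <=: v -> x + u <=: y + v.
Proof.
move=> xy uv; apply: (@rle_trans (y + u)); first exact: rs_add.
by rewrite ![y + _]addrC; apply: rs_add.
Qed.

Lemma rleD2r z x y : x + z <=: y + z <-> x <=: y.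
Proof.
split=> [h|]; last exact: rs_add.
by have := rs_add (- z) h; rewrite !addrK.
Qed.

Lemma rsub_ge0 x y : 0 <=: y - x <-> x <=: y.
Proof. by rewrite -(rleD2r x) add0r subrK. Qed.

Lemma rleN x y : - x <=: - y <-> y <=: x.
Proof. by rewrite -rsub_ge0 opprK addrC rsub_ge0. Qed.

Lemma rleBl x y z : x - z <=: y <-> x <=: y + z.
Proof. by rewrite -(rleD2r z) subrK. Qed.

Lemma rleBr x y z : x <=: y - z <-> x + z <=: y.
Proof. by rewrite -(rleD2r z) subrK. Qed.

Lemma rle_subr x y : x <=: x - y <-> y <=: 0.
Proof. by rewrite rleBr -[X in _ <=: X]add0r [x + y]addrC rleD2r. Qed.

Lemma raddr_ge0 x y : 0 <=: x -> 0 <=: y -> 0 <=: x + y.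
Proof. by move=> x0 y0; rewrite -[0]addr0; apply: rleD. Qed.

Lemma rle_addr x y : 0 <=: y -> x <=: x + y.
Proof. by move=> y0; rewrite -{1}[x]addr0; apply: rleD. Qed.

Lemma rscale_ge0 a x : 0 <= a -> 0 <=: x -> 0 <=: a *: x.
Proof. by move=> a0 x0; rewrite -(scaler0 V a); apply: rs_scale. Qed.

Lemma rscale_le a b x : a <= b -> 0 <=: x -> a *: x <=: b *: x.
Proof.
by move=> ab x0; apply/rsub_ge0; rewrite -scalerBl; apply: rscale_ge0; rewrite ?subr_ge0.
Qed.

Lemma rscale_leP a x y : 0 < a -> a *: x <=: a *: y <-> x <=: y.
Proof.
move=> a0; split=> [h|]; last exact/rs_scale/ltW.
have ai : 0 <= a^-1 by rewrite invr_ge0 ltW.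
by have := rs_scale ai h; rewrite !scalerA mulVf ?gt_eqF// !scale1r.
Qed.

Definition rjoin x y : V := projT1 (cid (rs_lattice x y)).
Definition rmeet x y : V := - rjoin (- x) (- y).
(** Joins and meets are reduced to positive parts ([rjoin_rpos], [rmeet_rpos]), so that linear maps
    and subspaces need only be tested on [rpos]. *)
Definition rpos x : V := rjoin x 0.

Lemma rjoinP x y : is_sup (@rs_le R V) (pair2 x y) (rjoin x y).
Proof. by rewrite /rjoin; case: cid. Qed.

Lemma rle_joinl x y : x <=: rjoin x y.
Proof. by case: (rjoinP x y) => h _; apply: h; left. Qed.

Lemma rle_joinr x y : y <=: rjoin x y.
Proof. by case: (rjoinP x y) => h _; apply: h; right. Qed.

Lemma rjoin_le x y z : x <=: z -> y <=: z -> rjoin x y <=: z.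
Proof. by move=> xz yz; case: (rjoinP x y) => _; apply=> t [->|->]. Qed.

Lemma rmeet_lel x y : rmeet x y <=: x.
Proof. by rewrite /rmeet -{2}[x]opprK; apply/rleN/rle_joinl. Qed.

Lemma rmeet_ler x y : rmeet x y <=: y.
Proof. by rewrite /rmeet -{2}[y]opprK; apply/rleN/rle_joinr. Qed.

Lemma rle_meet x y z : z <=: x -> z <=: y -> z <=: rmeet x y.
Proof.
by move=> zx zy; rewrite /rmeet -[z]opprK; apply/rleN/rjoin_le; apply/rleN.
Qed.

Lemma is_meetP x y m :
  is_meet (@rs_le R V) x y m <-> [/\ m <=: x, m <=: y & forall z, z <=: x -> z <=: y -> z <=: m].
Proof.
split=> [[lb gb]|[mx my gb]].
  split; [by apply: lb; left|by apply: lb; right|].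
  by move=> z zx zy; apply: gb => t [->|->].
by split=> [t [->|->]//|z lb]; apply: gb; apply: lb; [left|right].
Qed.

Lemma rmeetP x y : is_meet (@rs_le R V) x y (rmeet x y).
Proof.
by apply/is_meetP; split; [exact: rmeet_lel|exact: rmeet_ler|move=> z; exact: rle_meet].
Qed.

Lemma is_meet_rmeet x y m : is_meet (@rs_le R V) x y m <-> rmeet x y = m.
Proof.
split=> [/is_meetP[mx my gb]|<-]; last exact: rmeetP.
apply: rs_antisym; first by apply: gb; [exact: rmeet_lel|exact: rmeet_ler].
exact: rle_meet.
Qed.

Lemma rmeetC x y : rmeet x y = rmeet y x.
Proof. by apply/is_meet_rmeet/is_meetP; split; [exact: rmeet_ler|exact: rmeet_lel|move=> z *; exact: rle_meet]. Qed.

Lemma rjoin_rpos x y : rjoin x y = y + rpos (x - y).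
Proof.
apply: rs_antisym.
  apply: rjoin_le; last exact/rle_addr/rle_joinr.
  by rewrite addrC; apply/rleBl/rle_joinl.
rewrite addrC; apply/rleBr/rjoin_le.
  by apply/rleD2r/rle_joinl.
by apply/rsub_ge0/rle_joinr.
Qed.

Lemma rmeet_rpos x y : rmeet x y = y - rpos (y - x).
Proof. by rewrite /rmeet rjoin_rpos opprD !opprK [- x + y]addrC. Qed.

Lemma rpos_ge0 x : 0 <=: rpos x. Proof. exact: rle_joinr. Qed.
Lemma rle_rpos x : x <=: rpos x. Proof. exact: rle_joinl. Qed.
Hint Resolve rpos_ge0 rle_rpos : core.

Lemma rpos_le x y : x <=: y -> 0 <=: y -> rpos x <=: y.
Proof. exact: rjoin_le. Qed.

Lemma rpos_mono x y : x <=: y -> rpos x <=: rpos y.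
Proof. by move=> xy; apply: rpos_le => //; apply: rle_trans xy _. Qed.

Lemma rposD x y : rpos (x + y) <=: rpos x + rpos y.
Proof. by apply: rpos_le; [exact: rleD|exact: raddr_ge0]. Qed.

Lemma rpos_id x : 0 <=: x -> rpos x = x.
Proof. by move=> x0; apply: rs_antisym => //; apply: rpos_le. Qed.

Lemma rpos_eq0 x : x <=: 0 -> rpos x = 0.
Proof. by move=> x0; apply: rs_antisym => //; apply: rpos_le. Qed.

Lemma rpos_eq0_le x : rpos x = 0 -> x <=: 0.
Proof. by move=> <-. Qed.

Lemma rposZ a x : 0 < a -> rpos (a *: x) = a *: rpos x.
Proof.
move=> a0; apply: rs_antisym.
  by apply: rpos_le; [exact/rscale_leP|apply: rscale_ge0 => //; exact: ltW].
apply/(@rscale_leP a^-1); rewrite ?invr_gt0// scalerA mulVf ?gt_eqF// scale1r.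
apply: rpos_le; last by apply: rscale_ge0; rewrite // invr_ge0 ltW.
by apply/(@rscale_leP a) => //; rewrite scalerA mulfV ?gt_eqF// scale1r.
Qed.

Lemma rpos_sub x : rpos x - rpos (- x) = x.
Proof.
suff -> : rpos x = x + rpos (- x) by rewrite addrK.
have := rjoin_rpos 0 x; rewrite sub0r => <-.
by apply: rs_antisym; apply: rjoin_le; (exact: rle_joinl || exact: rle_joinr).
Qed.

Definition disj x y := rmeet x y = 0.

Lemma disjP x y : 0 <=: x -> 0 <=: y ->
  disj x y <-> (forall z, z <=: x -> z <=: y -> z <=: 0).
Proof.
move=> x0 y0; split=> [d z zx zy|h].
  by rewrite -d; apply: rle_meet.
by apply/is_meet_rmeet/is_meetP.
Qed.

Lemma disj_le x y z : disj x y -> z <=: x -> z <=: y -> z <=: 0.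
Proof. by move=> <- zx zy; apply: rle_meet. Qed.

Lemma disjC x y : disj x y -> disj y x.
Proof. by rewrite /disj rmeetC. Qed.

Lemma disj_mono x y m n : 0 <=: x -> 0 <=: m -> x <=: y -> m <=: n -> disj y n -> disj x m.
Proof.
move=> x0 m0 xy mn d; apply/disjP => // z zx zm.
by apply: (disj_le d); [exact: rle_trans zx xy|exact: rle_trans zm mn].
Qed.

(** For a common lower bound [z] of [x + y] and [m], the positive part of [z - x] is below both [y]
    and [m], so [z <=: x]. *)
Lemma disjD x y m : 0 <=: x -> 0 <=: y -> 0 <=: m -> disj x m -> disj y m -> disj (x + y) m.
Proof.
move=> x0 y0 m0 dx dy; apply/disjP => //; first exact: raddr_ge0.
move=> z zxy zm.
have zy : rpos (z - x) <=: 0.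
  apply: (disj_le dy); first by apply: rpos_le => //; apply/rleBl; rewrite addrC.
  apply: rpos_le => //; apply: rle_trans zm; apply/rleBl; exact: rle_addr.
apply: (disj_le dx) => //.
by rewrite -[x]add0r; apply/rleBl; apply: rle_trans zy.
Qed.

Lemma disj0r x : 0 <=: x -> disj x 0.
Proof. by move=> x0; apply/disjP. Qed.

Lemma disj0l x : 0 <=: x -> disj 0 x.
Proof. by move=> x0; apply/disjP. Qed.

Lemma disjxx x : disj x x -> 0 <=: x -> x = 0.
Proof. by move=> d x0; apply: rs_antisym => //; apply: (disj_le d). Qed.

Lemma disjZ a x m : 0 <= a -> 0 <=: x -> 0 <=: m -> disj x m -> disj (a *: x) m.
Proof.
move=> a0 x0 m0 d; apply/disjP => //; first exact: rscale_ge0.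
move=> z zx zm.
(* [a + 1] is positive and at least both [a] and [1], so dividing [z] by it gives a common lower
   bound of [x] and [m]. *)
have b0 : 0 < a + 1 by rewrite ltr_wpDl.
apply/(@rscale_leP (a + 1)^-1); first by rewrite invr_gt0.
rewrite scaler0; apply: (disj_le d).
  apply/(@rscale_leP (a + 1)) => //; rewrite scalerA mulfV ?gt_eqF// scale1r.
  by apply: rle_trans zx _; apply: rscale_le => //; rewrite lerDl.
apply/(@rscale_leP (a + 1)) => //; rewrite scalerA mulfV ?gt_eqF// scale1r.
by apply: rle_trans zm _; rewrite -{1}[m]scale1r; apply: rscale_le => //; rewrite lerDr.
Qed.

(** A common lower bound [z] leaves [rpos x - z] above both [x] and [0], hence above [rpos x]. *)
Lemma disj_pos_neg x : disj (rpos x) (rpos (- x)).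
Proof.
apply/disjP => // z zx zn.
apply/(rle_subr (rpos x)).
apply: rpos_le; last by apply/rsub_ge0.
apply/rleBr; suff <- : x + rpos (- x) = rpos x by apply: rleD.
by rewrite -{1}(rpos_sub x) subrK.
Qed.

(** The positive part of [x - y] is below both [x] and [z], so it vanishes. *)
Lemma disj_le_add x y z : 0 <=: x -> 0 <=: y -> 0 <=: z -> disj x z -> x <=: y + z -> x <=: y.
Proof.
move=> x0 y0 z0 d xyz; apply/rsub_ge0; apply/rleN; rewrite oppr0 opprB.
apply: rle_trans (rle_rpos _) _; apply: (disj_le d).
  by apply: rpos_le => //; apply/rleBl; apply: rle_addr.
by apply: rpos_le => //; apply/rleBl; rewrite addrC.
Qed.

(* [leon m x y] is the order of the quotient by the polar of [m]; for
   continuous functions, [x <= y] on the cozero set of [m]. *)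
Definition leon m x y := disj (rpos (x - y)) m.

Lemma leon_le m x y : 0 <=: m -> x <=: y -> leon m x y.
Proof.
move=> m0 xy; rewrite /leon rpos_eq0; first exact: disj0l.
by rewrite -[0](subrr y); apply/rleD2r.
Qed.

Lemma leonD m x y u v : 0 <=: m -> leon m x y -> leon m u v -> leon m (x + u) (y + v).
Proof.
move=> m0 xy uv; apply: disj_mono (disjD _ _ _ xy uv) => //.
by rewrite opprD addrACA; apply: rposD.
Qed.

Lemma leon_trans m y x z : 0 <=: m -> leon m x y -> leon m y z -> leon m x z.
Proof.
move=> m0 xy yz; have := leonD m0 xy yz; rewrite /leon.
by have -> : x + y - (y + z) = x - z by rewrite opprD addrA addrK.
Qed.

Lemma leonN m x y : leon m (- x) (- y) <-> leon m y x.
Proof. by rewrite /leon opprK addrC. Qed.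

Lemma leonZ m a x y : 0 <=: m -> 0 <= a -> leon m x y -> leon m (a *: x) (a *: y).
Proof.
rewrite le_eqVlt => m0 /orP[/eqP<- _|a0 xy]; first by rewrite !scale0r; apply: leon_le.
by rewrite /leon -scalerBr rposZ//; apply: disjZ => //; apply: ltW.
Qed.

Lemma leon_rpos m x y : 0 <=: m -> leon m x y -> 0 <=: y -> leon m (rpos x) y.
Proof.
move=> m0 xy y0; apply: disj_mono xy => //.
apply: rpos_le => //; apply/rleBl; apply: rpos_le.
  by apply/rleBl.
exact: raddr_ge0.
Qed.

Lemma leon_mono m n x y : 0 <=: m -> m <=: n -> leon n x y -> leon m x y.
Proof. by move=> m0 mn; apply: disj_mono. Qed.

(** For continuous functions: [x / w] stays within [d] of [c] on the part of the cozero set of [m]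
    where [w] is nonzero. *)
Definition near m w x c d := leon m x ((c + d) *: w) /\ leon m ((c - d) *: w) x.

Lemma near_mono m n w x c d : 0 <=: m -> m <=: n -> near n w x c d -> near m w x c d.
Proof. by move=> m0 mn [h1 h2]; split; apply: leon_mono mn _. Qed.

Lemma near_weak m w x c d d' : 0 <=: m -> 0 <=: w -> d <= d' -> near m w x c d -> near m w x c d'.
Proof.
move=> m0 w0 dd' [h1 h2]; split.
  by apply: leon_trans h1 _ => //; apply/leon_le => //; apply: rscale_le => //; rewrite lerD2l.
by apply: leon_trans h2 => //; apply/leon_le => //; apply: rscale_le => //; rewrite lerD2l lerN2.
Qed.

Lemma nearD m w x y c c' d d' : 0 <=: m ->
  near m w x c d -> near m w y c' d' -> near m w (x + y) (c + c') (d + d').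
Proof.
move=> m0 [h1 h2] [k1 k2]; split.
  by rewrite addrACA scalerDl; apply: leonD.
by rewrite opprD addrACA scalerDl; apply: leonD.
Qed.

Lemma nearN m w x c d : near m w x c d -> near m w (- x) (- c) d.
Proof.
move=> [h1 h2]; split; apply/leonN; rewrite opprK -scaleNr opprD !opprK //.
Qed.

Lemma nearZ m w a x c d : 0 <=: m -> near m w x c d -> near m w (a *: x) (a * c) (`|a| * d).
Proof.
move=> m0; wlog a0 : a x c / 0 <= a.
  move=> h; have [/h|a0 n] := leP 0 a; first exact.
  have := h (- a) (- x) (- c); rewrite oppr_ge0 normrN scalerN scaleNr mulrNN opprK.
  by apply; [exact: ltW|exact: nearN].
case=> [h1 h2]; rewrite ger0_norm//; split.
  by rewrite -mulrDr -scalerA; apply: leonZ.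
by rewrite -mulrBr -scalerA; apply: leonZ.
Qed.

Lemma near_pos m w x c d : 0 <=: m -> 0 <=: w -> 0 <= d ->
  near m w x c d -> near m w (rpos x) (Num.max c 0) d.
Proof.
move=> m0 w0 d0 [h1 h2]; split.
  apply: leon_rpos => //; last first.
    by apply: rscale_ge0 => //; apply: addr_ge0 => //; rewrite le_max lexx orbT.
  apply: leon_trans h1 _ => //; apply: leon_le => //; apply: rscale_le => //.
  by rewrite lerD2r le_max lexx.
have [c0|c0] := leP c 0.
  apply: leon_le => //; apply: rle_trans (rpos_ge0 x).
  rewrite sub0r scaleNr -oppr0; apply/rleN; exact: rscale_ge0.
by apply: leon_trans h2 _ => //; apply: leon_le.
Qed.

(** If [d < c], the difference is a positive multiple of [w] that is disjoint from [m]. *)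
Lemma leon_scale_le m w c d : 0 <=: m -> 0 <=: w -> ~ disj w m ->
  leon m (c *: w) (d *: w) -> c <= d.
Proof.
move=> m0 w0 nd h; have [//|dc] := leP c d; exfalso; apply: nd.
have cd0 : 0 < c - d by rewrite subr_gt0.
move: h; rewrite /leon -scalerBl rpos_id; last by apply: rscale_ge0 => //; apply: ltW.
move=> h; have : disj ((c - d)^-1 *: ((c - d) *: w)) m.
  by apply: disjZ => //; [rewrite invr_ge0 ltW|apply: rscale_ge0 => //; apply: ltW].
by rewrite scalerA mulVf ?gt_eqF// scale1r.
Qed.

Lemma near_unique m w x c c' d d' : 0 <=: m -> 0 <=: w -> ~ disj w m ->
  near m w x c d -> near m w x c' d' -> `|c - c'| <= d + d'.
Proof.
move=> m0 w0 nd [h1 h2] [k1 k2].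
have := leon_scale_le m0 w0 nd (leon_trans m0 h2 k1).
have := leon_scale_le m0 w0 nd (leon_trans m0 k2 h1).
rewrite ler_norml => *; lra.
Qed.

Lemma weak_unit_disj w x : weak_unit w -> 0 <=: x -> disj w x -> x = 0.
Proof. by move=> [w0 h] x0 /disjC d; apply: h => //; apply/is_meet_rmeet. Qed.

Lemma componentP w p : component w p <-> [/\ 0 <=: p, p <=: w & disj (w - p) p].
Proof. by split=> [[? [? /is_meet_rmeet?]]|[? ? /is_meet_rmeet?]]. Qed.

(** Taking for [d] the inverses of the positive integers puts all multiples of [rpos x] below
    [y]. *)
Lemma archimedean_le x y : archimedean V -> 0 <=: y ->
  (forall d, 0 < d -> x <=: d *: y) -> x <=: 0.
Proof.
move=> arch y0 h; apply: rpos_eq0_le; apply: (arch _ y) => // n.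
rewrite -scaler_nat; case: n => [|n]; first by rewrite scale0r.
apply/(@rscale_leP (n.+1%:R)^-1); first by rewrite invr_gt0 ltr0n.
rewrite scalerA mulVf ?pnatr_eq0// scale1r.
have i0 : 0 < n.+1%:R^-1 :> R by rewrite invr_gt0 ltr0n.
by apply: rpos_le; [exact: h|apply: rscale_ge0 => //; apply: ltW].
Qed.

(** If [s] is the supremum of the multiples of [x], then [s - x] is again an upper bound of them. *)
Lemma dedekind_archimedean : dedekind_complete V -> archimedean V.
Proof.
move=> dc x y x0 h; apply: rs_antisym => //.
have [||s [ub lub]] := dc (fun z => exists n, z = x *+ n).
- by exists 0, 0%N.
- by exists y => _ [n ->].
apply/(rle_subr s).
by apply: lub => _ [n ->]; apply/rleBr; rewrite addrC -mulrS; apply: ub; exists n.+1.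
Qed.

End RieszTheory.
#[export] Hint Resolve rle_refl rpos_ge0 rle_rpos : core.

(** * Homomorphisms, subspaces and quotients *)

Section RieszHom.
Variables (R : realType) (V W : RieszSpace R) (T : V -> W).

Lemma rjoin_unique (x y s : V) : is_sup (@rs_le R V) (pair2 x y) s -> rjoin x y = s.
Proof.
move=> [ub lub]; apply: rs_antisym; last first.
  by apply: lub => z [->|->]; [exact: rle_joinl|exact: rle_joinr].
by apply: rjoin_le; apply: ub; [left|right].
Qed.

Lemma riesz_hom_of_rpos : {morph T : x y / x + y} -> (forall a, {morph T : x / a *: x}) ->
  {morph T : x / rpos x} -> riesz_hom T.
Proof.
move=> TD TZ Tp; split; [exact: TD|split; first exact: TZ].
move=> x y m /is_meet_rmeet <-; apply/is_meet_rmeet.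
have TN z : T (- z) = - T z by rewrite -scaleN1r TZ scaleN1r.
by rewrite !rmeet_rpos TD TN Tp TD TN.
Qed.

Hypothesis hT : riesz_hom T.

Lemma rhomD : {morph T : x y / x + y}. Proof. by case: hT. Qed.
Lemma rhomZ a : {morph T : x / a *: x}. Proof. by case: hT => _ [h _] x; apply: h. Qed.
Lemma rhom0 : T 0 = 0. Proof. by rewrite -(scale0r 0) rhomZ !scale0r. Qed.
Lemma rhomN : {morph T : x / - x}.
Proof. by move=> x; rewrite -scaleN1r rhomZ scaleN1r. Qed.
Lemma rhomB : {morph T : x y / x - y}.
Proof. by move=> x y; rewrite rhomD rhomN. Qed.
Lemma rhom_meet : {morph T : x y / rmeet x y}.
Proof. by case: hT => _ [_ h] x y; apply/esym/is_meet_rmeet/h/rmeetP. Qed.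
Lemma rhom_pos : {morph T : x / rpos x}.
Proof.
move=> x; have := rhom_meet 0 x; rewrite !rmeet_rpos rhomB rhom0 !subr0.
by move/addrI/oppr_inj.
Qed.
Lemma rhom_le x y : x <=: y -> T x <=: T y.
Proof.
by move=> /rsub_ge0/rpos_id h; apply/rsub_ge0; rewrite -rhomB -h rhom_pos.
Qed.
Lemma rhom_ge0 x : 0 <=: x -> 0 <=: T x.
Proof. by move=> /rhom_le; rewrite rhom0. Qed.
Lemma rhom_disj x y : disj x y -> disj (T x) (T y).
Proof. by rewrite /disj -rhom_meet => ->; rewrite rhom0. Qed.
End RieszHom.

Record riesz_subspace (R : realType) (V : RieszSpace R) := {
  rsub_mem :> V -> Prop;
  rsub0 : rsub_mem 0;
  rsubD : forall x y, rsub_mem x -> rsub_mem y -> rsub_mem (x + y);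
  rsubZ : forall a x, rsub_mem x -> rsub_mem (a *: x);
  rsub_pos : forall x, rsub_mem x -> rsub_mem (rpos x) }.

Section SubRiesz.
Variables (R : realType) (V : RieszSpace R) (S : riesz_subspace V).

Definition rsub_pred : {pred V} := fun x => `[< S x >].

Lemma rsub_pred_closed : submod_closed rsub_pred.
Proof.
split; first exact/asboolP/rsub0.
by move=> a x y /asboolP hx /asboolP hy; apply/asboolP/rsubD => //; apply: rsubZ.
Qed.

HB.instance Definition _ := GRing.isSubmodClosed.Build R V rsub_pred rsub_pred_closed.

Definition rsub_car := {x : V | rsub_pred x}.
HB.instance Definition _ := SubType.on rsub_car.
HB.instance Definition _ := Choice.on rsub_car.
HB.instance Definition _ := [SubChoice_isSubLmodule of rsub_car by <:].

Definition rsub_le (x y : rsub_car) := val x <=: val y.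

Lemma rsub_lattice (x y : rsub_car) : exists s, is_sup rsub_le (pair2 x y) s.
Proof.
have h : rsub_pred (rjoin (val x) (val y)).
  apply/asboolP; rewrite rjoin_rpos; apply: rsubD; first exact/asboolP/(valP y).
  apply: rsub_pos; apply: rsubD; first exact/asboolP/(valP x).
  by rewrite -scaleN1r; apply/rsubZ/asboolP/(valP y).
exists (Sub _ h : rsub_car); split=> [z [->|->]|z ub].
- exact: rle_joinl.
- exact: rle_joinr.
- by apply: rjoin_le; apply: ub; [left|right].
Qed.

Definition rsub_riesz : RieszSpace R.
refine (@Build_RieszSpace R rsub_car rsub_le _ _ _ _ _ rsub_lattice).
- by move=> x; apply: rle_refl.
- by move=> x y xy yx; apply/val_inj/rs_antisym.
- by move=> x y z; apply: rle_trans.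
- by move=> x y z; apply: rs_add.
- by move=> a x y; apply: rs_scale.
Defined.

Definition rval (z : rsub_riesz) : V := val (z : rsub_car).
Definition rsub_mk (x : V) (Sx : S x) : rsub_riesz := Sub x (asboolT Sx) : rsub_car.

Lemma rsub_mkK (x : V) (Sx : S x) : rval (rsub_mk Sx) = x. Proof. by []. Qed.
Lemma rvalP z : S (rval z). Proof. exact/asboolP/(valP (z : rsub_car)). Qed.
Lemma rval_inj : injective rval. Proof. exact: val_inj. Qed.
Lemma rvalD : {morph rval : x y / x + y}. Proof. by []. Qed.
Lemma rvalZ a : {morph rval : x / a *: x}. Proof. by []. Qed.
Lemma rval0 : rval 0 = 0. Proof. by []. Qed.
Lemma rval_leE x y : (x <=: y) = (rval x <=: rval y). Proof. by []. Qed.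

Lemma rval_pos : {morph rval : x / rpos x}.
Proof.
move=> z; have h : S (rpos (rval z)) by apply/rsub_pos/rvalP.
rewrite -(rsub_mkK h); congr rval; apply: rjoin_unique; split=> [t [->|->]|t ub].
- exact: (rle_rpos (rval z)).
- exact: (rpos_ge0 (rval z)).
- by apply: rpos_le; [exact: (ub z (or_introl erefl))|exact: (ub 0 (or_intror erefl))].
Qed.

Lemma rvalMn x n : rval (x *+ n) = rval x *+ n.
Proof. by rewrite -!scaler_nat rvalZ. Qed.

Lemma rsub_archimedean : archimedean V -> archimedean rsub_riesz.
Proof.
move=> arch x y x0 h; apply: rval_inj; apply: (arch _ (rval y)) => // n.
by have := h n; rewrite rval_leE rvalMn.
Qed.

End SubRiesz.

(* A vector lattice up to null elements; quotienting by [x <= 0 <= x] turns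
   it into a Riesz space. *)
Record riesz_preorder (R : realType) (V : lmodType R) := {
  rpre_le :> V -> V -> Prop;
  rpre_refl : forall x, rpre_le x x;
  rpre_trans : forall x y z, rpre_le x y -> rpre_le y z -> rpre_le x z;
  rpre_add : forall x y z, rpre_le x y -> rpre_le (x + z) (y + z);
  rpre_scale : forall (a : R) x y, 0 <= a -> rpre_le x y -> rpre_le (a *: x) (a *: y);
  rpre_lattice : forall x y, exists s, is_sup rpre_le (pair2 x y) s }.

Section QuotRiesz.
Local Open Scope quotient_scope.
Variables (R : realType) (V : lmodType R) (L : riesz_preorder V).

Definition rnull : {pred V} := fun x => `[< L x 0 /\ L 0 x >].

Lemma rpre_sub0 x y : L x y <-> L (x - y) 0.
Proof.
by split=> [/(rpre_add (- y))|/(rpre_add y)]; rewrite ?subrr// subrK add0r.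
Qed.

Lemma rpre_opp x : L x 0 -> L 0 (- x).
Proof. by move/(rpre_add (- x)); rewrite subrr add0r. Qed.

Lemma rpre_opp' x : L 0 x -> L (- x) 0.
Proof. by move/(rpre_add (- x)); rewrite subrr add0r. Qed.

Lemma rnull_zmod : zmod_closed rnull.
Proof.
split; first by apply/asboolP; split; apply: rpre_refl.
move=> x y /asboolP[x0 x0'] /asboolP[y0 y0']; apply/asboolP; split.
  by apply: rpre_trans (rpre_add (- y) x0) _; rewrite add0r; apply: rpre_opp'.
by apply: rpre_trans (rpre_opp y0) _; rewrite -{1}[- y]add0r; apply: rpre_add.
Qed.

HB.instance Definition _ := GRing.isZmodClosed.Build V rnull rnull_zmod.

Definition rquot := Quotient.quot rnull.
HB.instance Definition _ := GRing.Zmodule.on rquot.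
HB.instance Definition _ := EqQuotient.on rquot.

Definition rpi (x : V) : rquot := \pi x.

Lemma rpi_eq x y : rpi x = rpi y <-> L x y /\ L y x.
Proof.
have -> : (rpi x = rpi y) <-> (x - y) \in rnull.
  rewrite (Quotient.idealrBE rnull); split=> [h|/eqP h]; [apply/eqP|]; exact: h.
rewrite /in_mem/=; split=> [/asboolP[h k]|[h k]].
  by split; apply/rpre_sub0 => //; rewrite -opprB; apply: rpre_opp'.
apply/asboolP; split; first exact: (iffLR (rpre_sub0 _ _)).
by rewrite -opprB; exact/rpre_opp/(iffLR (rpre_sub0 _ _)).
Qed.

Lemma rpiD : {morph rpi : x y / x + y}.
Proof. by move=> x y; rewrite /rpi !piE. Qed.

Lemma rpi_surj (z : rquot) : exists x, z = rpi x.
Proof. by exists (repr z); rewrite /rpi reprK. Qed.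

(** Scaling and order of the quotient are read off representatives; [rpiZ] and [rquot_leE] show that
    the choice is irrelevant. *)
Definition rquot_scale (a : R) (z : rquot) : rquot := rpi (a *: repr z).

Lemma rpre_scale_eq a x y : L x y -> L y x -> L (a *: x) (a *: y).
Proof.
move=> xy yx; have [a0|/ltW a0] := leP 0 a; first exact: rpre_scale.
have na0 : 0 <= - a by rewrite oppr_ge0.
have := rpre_add (a *: x + a *: y) (rpre_scale na0 yx).
by rewrite !scaleNr addrCA addNr addr0 addKr.
Qed.

Lemma rpiZ a x : rpi (a *: x) = rquot_scale a (rpi x).
Proof.
have /rpi_eq[h k] : rpi x = rpi (repr (rpi x)) by rewrite /rpi reprK.
by apply/rpi_eq; split; apply: rpre_scale_eq.
Qed.

Lemma rquot_scaleA a b z : rquot_scale a (rquot_scale b z) = rquot_scale (a * b) z.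
Proof. by have [x ->] := rpi_surj z; rewrite -!rpiZ scalerA. Qed.

Lemma rquot_scale1 : left_id 1 rquot_scale.
Proof. by move=> z; have [x ->] := rpi_surj z; rewrite -rpiZ scale1r. Qed.

Lemma rquot_scaleDr : right_distributive rquot_scale +%R.
Proof.
move=> a z w; have [x ->] := rpi_surj z; have [y ->] := rpi_surj w.
by rewrite -rpiD -!rpiZ scalerDr rpiD.
Qed.

Lemma rquot_scaleDl z : {morph rquot_scale^~ z : a b / a + b}.
Proof.
by move=> a b; have [x ->] := rpi_surj z; rewrite -!rpiZ scalerDl rpiD.
Qed.

HB.instance Definition _ := GRing.Zmodule_isLmodule.Build R rquot
  rquot_scaleA rquot_scale1 rquot_scaleDr rquot_scaleDl.

Definition rquot_le (z w : rquot) := L (repr z) (repr w).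

Lemma rquot_leE x y : rquot_le (rpi x) (rpi y) <-> L x y.
Proof.
have /rpi_eq[xh hx] : rpi x = rpi (repr (rpi x)) by rewrite /rpi reprK.
have /rpi_eq[yh hy] : rpi y = rpi (repr (rpi y)) by rewrite /rpi reprK.
split=> h.
  by apply: rpre_trans xh (rpre_trans h hy).
by apply: rpre_trans hx (rpre_trans h yh).
Qed.

Lemma rquot_sup x y s : is_sup L (pair2 x y) s -> is_sup rquot_le (pair2 (rpi x) (rpi y)) (rpi s).
Proof.
move=> [ub lub]; split=> [z [->|->]|z h].
- by apply/rquot_leE/ub; left.
- by apply/rquot_leE/ub; right.
move: h; have [t ->] := rpi_surj z; move=> h; apply/rquot_leE/lub => r [->|->].
  by apply/rquot_leE/h; left.
by apply/rquot_leE/h; right.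
Qed.

Definition rquot_riesz : RieszSpace R.
refine (@Build_RieszSpace R rquot rquot_le _ _ _ _ _ _).
- by move=> z; apply: rpre_refl.
- move=> z w; have [x ->] := rpi_surj z; have [y ->] := rpi_surj w.
  by move=> /rquot_leE xy /rquot_leE yx; apply/rpi_eq.
- by move=> x y z; apply: rpre_trans.
- move=> z w u; have [x ->] := rpi_surj z; have [y ->] := rpi_surj w.
  have [t ->] := rpi_surj u; move=> /rquot_leE h.
  by rewrite -!rpiD; apply/rquot_leE/rpre_add.
- move=> a z w; have [x ->] := rpi_surj z; have [y ->] := rpi_surj w.
  move=> a0 /rquot_leE h; rewrite /GRing.scale/= -!rpiZ.
  by apply/rquot_leE/rpre_scale.
- move=> z w; have [x ->] := rpi_surj z; have [y ->] := rpi_surj w.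
  by have [s /rquot_sup hs] := rpre_lattice L x y; exists (rpi s).
Defined.

Definition rproj : V -> rquot_riesz := rpi.

Lemma rprojD : {morph rproj : x y / x + y}. Proof. exact: rpiD. Qed.
Lemma rprojZ a : {morph rproj : x / a *: x}. Proof. exact: rpiZ. Qed.
Lemma rproj_le x y : rproj x <=: rproj y <-> L x y. Proof. exact: rquot_leE. Qed.
Lemma rproj_eq x y : rproj x = rproj y <-> L x y /\ L y x. Proof. exact: rpi_eq. Qed.
Lemma rproj0 : rproj 0 = 0. Proof. by rewrite -(scale0r 0) rprojZ !scale0r. Qed.
Lemma rproj_pos x s : is_sup L (pair2 x 0) s -> rpos (rproj x) = rproj s.
Proof. by move=> /rquot_sup h; apply: rjoin_unique; rewrite -rproj0. Qed.

End QuotRiesz.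

(** * Functions modulo dense sets *)

Section DenseFunctions.
Variables (R : realType) (T : Type) (below : T -> T -> Prop).
Hypotheses (belowxx : forall t, below t t)
  (below_trans : forall s t r, below t s -> below s r -> below t r).

(* [A] holds on a dense open set, for the topology of lower sets of [T]. *)
Definition ev (A : T -> Prop) :=
  forall t, exists2 s, below s t & forall r, below r s -> A r.

Lemma ev_all (A : T -> Prop) : (forall t, A t) -> ev A.
Proof. by move=> h t; exists t. Qed.

Lemma ev_and (A B C : T -> Prop) : (forall t, A t -> B t -> C t) -> ev A -> ev B -> ev C.
Proof.
move=> h evA evB t; have [s st sA] := evA t; have [r rs rB] := evB s.
exists r; first exact: below_trans rs st.
by move=> u ur; apply: h; [apply: sA; exact: below_trans ur rs|exact: rB].
Qed.

Lemma ev_imp (A B : T -> Prop) : (forall t, A t -> B t) -> ev A -> ev B.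
Proof. by move=> h evA; apply: (ev_and _ evA evA) => t /h. Qed.

Implicit Types g h : T -> R^o.

(** The dense open set may depend on [d], since only finite intersections of such sets are taken
    ([ev_and]). *)
Definition dle g h := forall d : R, 0 < d -> ev (fun t => g t <= h t + d).

Lemma dle_pt g h : (forall t, g t <= h t) -> dle g h.
Proof. by move=> gh d d0; apply: ev_all => t; rewrite ler_wpDr// ltW. Qed.

Lemma dle_trans g h k : dle g h -> dle h k -> dle g k.
Proof.
move=> gh hk d d0; have d2 : 0 < d / 2 by lra.
by apply: ev_and (gh _ d2) (hk _ d2) => t; lra.
Qed.

Lemma dle_add g h k : dle g h -> dle (g + k) (h + k).
Proof. by move=> gh d /gh; apply: ev_imp => t; rewrite !fctE; lra. Qed.

Lemma dle_scale (a : R) g h : 0 <= a -> dle g h -> dle (a *: g) (a *: h).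
Proof.
(* The tolerance is divided by [a + 1] rather than [a], which may be zero. *)
move=> a0 gh d d0; have a1 : 0 < a + 1 by lra.
have := gh (d / (a + 1)) (divr_gt0 d0 a1); apply: ev_imp => t ght.
rewrite !scalrfctE /GRing.scale/=.
have := ler_wpM2l a0 ght; rewrite mulrDr => h'; apply: le_trans h' _.
by rewrite lerD2l mulrA ler_pdivrMr//; nra.
Qed.

Lemma dle_sup g h : is_sup dle (pair2 g h) (fun t => Num.max (g t) (h t)).
Proof.
split=> [k [->|->]|k ub].
- by apply: dle_pt => t; rewrite le_max lexx.
- by apply: dle_pt => t; rewrite le_max lexx orbT.
move=> d d0; apply: ev_and (ub g (or_introl erefl) d d0) (ub h (or_intror erefl) d d0).
by move=> t; rewrite ge_max => -> ->.
Qed.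

Definition dense_preorder : riesz_preorder (T -> R^o).
Proof.
exists dle.
- by move=> g; apply: dle_pt.
- exact: dle_trans.
- by move=> *; apply: dle_add.
- by move=> *; apply: dle_scale.
- by move=> g h; eexists; apply: dle_sup.
Defined.

Local Notation Q := (rquot_riesz dense_preorder).
Local Notation pi := (@rproj _ _ dense_preorder).

Lemma dproj_pos g : rpos (pi g) = pi (fun t => Num.max (g t) 0).
Proof. exact/rproj_pos/dle_sup. Qed.

Lemma dproj_eq g h : (forall d : R, 0 < d -> ev (fun t => `|g t - h t| <= d)) -> pi g = pi h.
Proof.
move=> H; apply/rproj_eq.
by split=> d /H; apply: ev_imp => t; rewrite ler_norml; lra.
Qed.

(** Local boundedness makes the quotient Archimedean ([lb_archimedean]) and the product independent
    of the representatives ([pair_prod_eq]). *)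
Definition locally_bounded g :=
  forall t, exists2 s, below s t & exists M : R, forall r, below r s -> `|g r| <= M.

Lemma locally_bounded_dom g h k (a b : R) : locally_bounded g -> locally_bounded h ->
  (forall t, `|k t| <= a * `|g t| + b * `|h t|) -> locally_bounded k.
Proof.
move=> bg bh kgh t; have [s st [M sM]] := bg t; have [r rs [N rN]] := bh s.
exists r; first exact: below_trans rs st.
exists (`|a| * M + `|b| * N) => u ur; apply: le_trans (kgh u) _.
by apply: lerD; apply: le_trans (ler_wpM2r _ (ler_norm _)) _ => //;
  apply: ler_wpM2l => //; [apply/sM/(below_trans ur)|exact: rN].
Qed.

Lemma locally_boundedM g h : locally_bounded g -> locally_bounded h ->
  locally_bounded (fun t => g t * h t).
Proof.
move=> bg bh t; have [s st [M sM]] := bg t; have [r rs [N rN]] := bh s.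
exists r; first exact: below_trans rs st.
exists (M * N) => u ur; rewrite normrM.
by apply: ler_pM => //; [apply/sM/(below_trans ur)|exact: rN].
Qed.

Definition lb_subspace : riesz_subspace Q.
Proof.
exists (fun z => exists2 g, z = pi g & locally_bounded g).
- exists (fun=> 0); first by rewrite -rproj0.
  by move=> t; exists t => //; exists 0 => r _; rewrite normr0.
- move=> _ _ [g -> bg] [h -> bh]; exists (g + h); first by rewrite rprojD.
  apply: (@locally_bounded_dom _ _ _ 1 1 bg bh) => t.
  by rewrite !mul1r ler_normD.
- move=> a _ [g -> bg]; exists (a *: g); first by rewrite rprojZ.
  apply: (@locally_bounded_dom _ _ _ `|a| 0 bg bg) => t.
  by rewrite mul0r addr0 scalrfctE /GRing.scale/= normrM.
- move=> _ [g -> bg]; exists (fun t => Num.max (g t) 0); first exact: dproj_pos.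
  apply: (@locally_bounded_dom _ _ _ 1 0 bg bg) => t.
  rewrite mul1r mul0r addr0; have [_|/ltW h] := leP (g t) 0; first by rewrite normr0.
  by [].
Defined.

(** Where [k] is bounded by [M], choose [n] with [M + 1 <= n d]. On a dense lower set
    [n g <= k + 1 <= n d], so [g <= d] there. *)
Lemma lb_archimedean : archimedean (rsub_riesz lb_subspace).
Proof.
move=> x y x0 h; apply: rval_inj.
have [g xg _] := rvalP x; have [k yk bk] := rvalP y.
rewrite xg; apply: rs_antisym; last by move: x0; rewrite rval_leE xg.
rewrite rval0 -rproj0; apply/rproj_le => d d0 t.
have [s st [M sM]] := bk t.
have [n Mn] : exists n : nat, M + 1 <= n%:R * d.
  have [n hn] : exists n : nat, (M + 1) / d <= n%:R.
    exists (Num.trunc `|(M + 1) / d|).+1; apply: le_trans (ler_norm _) _.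
    by rewrite ltW// truncnS_gt.
  by exists n; rewrite -ler_pdivrMr.
have /rproj_le : pi (n%:R *: g) <=: pi k.
  by rewrite rprojZ scaler_nat -xg -yk; have := h n; rewrite rval_leE rvalMn.
move=> /(_ 1 ltr01 s)[r rs rn]; exists r; first exact: below_trans rs st.
move=> u ur; have := rn u ur; have := sM u (below_trans ur rs).
rewrite scalrfctE /GRing.scale/= ler_norml => /andP[_ kM] nk.
have : n%:R * g u <= n%:R * d by lra.
(* [n = 0] would make the bound [M] of [|k|] negative. *)
have [n0|n0] := eqVneq n 0%N; last by rewrite ler_pM2l ?ltr0n ?lt0n// add0r.
exfalso; have := sM u (below_trans ur rs); rewrite ler_norml => /andP[].
by move: Mn; rewrite n0 mul0r; lra.
Qed.
End DenseFunctions.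

(** * Local values of [x / e] on the poset of positive nonzero elements *)

Section LocalValue.
Variables (R : realType) (E : RieszSpace R) (e : E).
Hypotheses (arch : archimedean E) (wue : weak_unit e).

Let e0 : 0 <=: e. Proof. by case: wue. Qed.

Lemma unit_ndisj p : 0 <=: p -> p <> 0 -> ~ disj e p.
Proof. by move=> p0 pn0 /(weak_unit_disj wue p0). Qed.

(** Here [a] is the modulus of [x]. If [p] were disjoint from [rpos (M *: e - a)] for all [M > 0],
    any common lower bound of [p] and [e] would be below every [d *: a], so [p] would be disjoint
    from the weak unit. For a suitable [M] the meet of the two is nonzero, and on it the modulus is
    at most [M *: e]. *)
Lemma near_bounded x p : 0 <=: p -> p <> 0 ->
  exists q M, [/\ 0 <=: q, q <> 0, q <=: p, 0 < M & near q e x 0 M].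
Proof.
move=> p0 pn0; pose a := rpos x + rpos (- x).
have a0 : 0 <=: a by apply: raddr_ge0.
have xa : x <=: a by apply: rle_trans (rle_rpos x) _; apply: rle_addr.
have xa' : - x <=: a.
  by apply: rle_trans (rle_rpos _) _; rewrite /a addrC; apply: rle_addr.
have [M M0 nd] : exists2 M : R, 0 < M & ~ disj p (rpos (M *: e - a)).
  apply: contrapT => H; apply: (unit_ndisj p0 pn0); apply: disjC; apply/disjP => // z zp ze.
  apply: rle_trans (rle_rpos z) _; apply: (archimedean_le arch a0) => d d0.
  have di : 0 < d^-1 by rewrite invr_gt0.
  have dM : disj p (rpos (d^-1 *: e - a)).
    by apply: contrapT => nd; apply: H; exists d^-1.
  have da0 : 0 <=: d *: a by apply: rscale_ge0 => //; apply: ltW.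
  apply: (@disj_le_add _ _ _ _ (d *: rpos (d^-1 *: e - a))) => //.
  - by apply: rscale_ge0 => //; apply: ltW.
  - apply/disjC/disjZ => //; first exact: ltW.
    apply/disjC; apply: (disj_mono (rpos_ge0 z) _ _ (rle_refl _)) dM => //.
    exact: rpos_le.
  - apply: rpos_le; last first.
      by apply: raddr_ge0 => //; apply: rscale_ge0 => //; apply: ltW.
    apply: rle_trans ze _; rewrite -scalerDr.
    apply/(@rscale_leP _ _ d^-1) => //; rewrite scalerA mulVf ?gt_eqF// scale1r.
    by rewrite addrC; apply/rleBl.
have rp : rmeet p (rpos (M *: e - a)) <=: rpos (M *: e - a) by apply: rmeet_ler.
have q0 : 0 <=: rmeet p (rpos (M *: e - a)) by apply: rle_meet.
exists (rmeet p (rpos (M *: e - a))), M; split=> //; first exact: rmeet_lel.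
have d : disj (rpos (a - M *: e)) (rmeet p (rpos (M *: e - a))).
  apply: (disj_mono (rpos_ge0 _) q0 (rle_refl _) rp).
  by rewrite -[a - _]opprB; apply/disjC/disj_pos_neg.
split; apply: disj_mono d => //; apply: rpos_mono.
  by rewrite add0r; apply: rleD.
by rewrite sub0r scaleNr addrC; apply: rleD.
Qed.

(** Bisection: either [x] is at most [c *: e] on all of [p], or [p] meets [rpos (x - c *: e)], and
    [x] is at least [c *: e] on that meet. *)
Lemma near_halve x p c d : 0 <=: p -> p <> 0 -> 0 < d -> near p e x c d ->
  exists q c', [/\ 0 <=: q, q <> 0, q <=: p & near q e x c' (d / 2)].
Proof.
move=> p0 pn0 d0 [h1 h2]; have [dj|nd] := pselect (disj (rpos (x - c *: e)) p).
  exists p, (c - d / 2); split=> //; split.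
    by have -> : c - d / 2 + d / 2 = c by lra.
  by have -> : c - d / 2 - d / 2 = c - d by lra.
have qp := rmeet_ler (rpos (x - c *: e)) p.
have q0 : 0 <=: rmeet (rpos (x - c *: e)) p by apply: rle_meet.
exists (rmeet (rpos (x - c *: e)) p), (c + d / 2); split=> //; split.
  have -> : c + d / 2 + d / 2 = c + d by lra.
  exact: leon_mono h1.
have -> : c + d / 2 - d / 2 = c by lra.
apply: (disj_mono (rpos_ge0 _) q0 (rle_refl _) (rmeet_lel _ _)).
by rewrite -[c *: e - x]opprB; apply/disjC/disj_pos_neg.
Qed.

Lemma near_exists x p d : 0 <=: p -> p <> 0 -> 0 < d ->
  exists q c, [/\ 0 <=: q, q <> 0, q <=: p & near q e x c d].
Proof.
move=> p0 pn0 d0; have [q [M [q0 qn0 qp M0 nq]]] := near_bounded x p0 pn0.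
have H n : exists r c, [/\ 0 <=: r, r <> 0, r <=: p & near r e x c (M / 2 ^+ n)].
  elim: n => [|n [r [c [r0 rn0 rp nr]]]]; first by exists q, 0; rewrite expr0 divr1.
  have Mn : 0 < M / 2 ^+ n by rewrite divr_gt0// exprn_gt0.
  have [s [c' [s0 sn0 sr ns]]] := near_halve r0 rn0 Mn nr.
  exists s, c'; split=> //; first exact: rle_trans rp.
  by rewrite exprSr invfM mulrA.
(* Since [n < 2 ^ n], this many halvings bring the radius [M] down to [d]. *)
have [n hn] : exists n : nat, M / d <= n%:R.
  exists (Num.trunc `|M / d|).+1; apply: le_trans (ler_norm _) _.
  by rewrite ltW// truncnS_gt.
have [r [c [r0 rn0 rp nr]]] := H n; exists r, c; split=> //.
apply: near_weak nr => //; rewrite ler_pdivrMr ?exprn_gt0// mulrC -ler_pdivrMr//.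
by apply: le_trans hn _; rewrite -natrX ler_nat ltnW// ltn_expl.
Qed.

Definition pos_elt := {p : E | 0 <=: p /\ p <> 0}.
Definition pos_below (p q : pos_elt) := sval p <=: sval q.

Lemma pos_belowxx p : pos_below p p. Proof. exact: rle_refl. Qed.
Lemma pos_below_trans s t r : pos_below t s -> pos_below s r -> pos_below t r.
Proof. exact: rle_trans. Qed.

Lemma pos_elt_ge0 (p : pos_elt) : 0 <=: sval p. Proof. by case: p => p []. Qed.
Lemma pos_elt_ndisj (p : pos_elt) : ~ disj e (sval p).
Proof. by case: p => p [p0 pn0] /=; apply: unit_ndisj. Qed.
Hint Resolve pos_elt_ge0 : core.

(** A relation, because [local_value] is additive only up to small errors, whereas representing
    functions may be added, scaled and truncated pointwise. *)
Definition represents (x : E) (c : pos_elt -> R) :=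
  forall d, 0 < d -> ev pos_below (fun p => near (sval p) e x (c p) d).

(** For continuous functions and [e = 1], the supremum of [x] on the cozero set of [p]. The default
    value of [inf] does no harm, as every [p] has some [q] below it on which [x] is bounded. *)
Definition local_value (x : E) (p : pos_elt) : R :=
  inf [set m | leon (sval p) x (m *: e)]%classic.

(** The infimum lies within [d] of [c], which doubles the radius. *)
Lemma near_local_value x p c d : 0 < d -> near (sval p) e x c d ->
  near (sval p) e x (local_value x p) (d + d).
Proof.
move=> d0 [h1 h2].
have lb : lbound [set m | leon (sval p) x (m *: e)]%classic (c - d).
  move=> m /= xm; apply: (leon_scale_le (pos_elt_ge0 p) e0 (@pos_elt_ndisj p)).
  exact: leon_trans h2 xm.
have l1 : c - d <= local_value x p by apply: lb_le_inf => //; exists (c + d).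
have l2 : local_value x p <= c + d by apply: ge_inf => //; exists (c - d).
split.
  by apply: leon_trans h1 _ => //; apply/leon_le => //; apply: rscale_le => //; lra.
by apply: leon_trans h2 => //; apply/leon_le => //; apply: rscale_le => //; lra.
Qed.

Lemma near_below x d (p : pos_elt) : 0 < d ->
  exists2 q : pos_elt, pos_below q p & exists c, near (sval q) e x c d.
Proof.
case: p => p [p0 pn0] d0; have [q [c' [q0 qn0 qp nq]]] := near_exists x p0 pn0 d0.
by exists (exist _ q (conj q0 qn0)) => //; exists c'.
Qed.

Lemma local_value_represents x : represents x (local_value x).
Proof.
move=> d d0 p; have d2 : 0 < d / 2 by lra.
have [q qp [c nq]] := near_below x p d2; exists q => // r rq.
have -> : d = d / 2 + d / 2 by lra.
by apply: (near_local_value (c := c)) => //; apply: near_mono nq.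
Qed.

Lemma representsD x y c c' : represents x c -> represents y c' ->
  represents (x + y) (fun p => c p + c' p).
Proof.
move=> hx hy d d0; have d2 : 0 < d / 2 by lra.
apply: (ev_and pos_below_trans _ (hx _ d2) (hy _ d2)) => p nx ny.
have -> : d = d / 2 + d / 2 by lra.
exact: nearD nx ny.
Qed.

Lemma representsZ a x c : represents x c -> represents (a *: x) (fun p => a * c p).
Proof.
move=> hx d d0; have a1 : 0 < `|a| + 1 by have := normr_ge0 a; lra.
have da : 0 < d / (`|a| + 1) by apply: divr_gt0.
apply: (ev_imp pos_below_trans _ (hx _ da)) => p nx.
apply: near_weak (nearZ a (pos_elt_ge0 p) nx) => //.
rewrite mulrA ler_pdivrMr//; nra.
Qed.

Lemma represents_pos x c : represents x c -> represents (rpos x) (fun p => Num.max (c p) 0).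
Proof.
move=> hx d d0; apply: (ev_imp pos_below_trans _ (hx _ d0)) => p.
by apply: near_pos => //; apply: ltW.
Qed.

Lemma represents_unique x c c' : represents x c -> represents x c' ->
  forall d : R, 0 < d -> ev pos_below (fun p => `|c p - c' p| <= d).
Proof.
move=> hx hy d d0; have d2 : 0 < d / 2 by lra.
apply: (ev_and pos_below_trans _ (hx _ d2) (hy _ d2)) => p nx ny.
have -> : d = d / 2 + d / 2 by lra.
exact: near_unique (@pos_elt_ndisj p) nx ny.
Qed.

Lemma represents_bounded x c : represents x c -> locally_bounded pos_below (c : _ -> R^o).
Proof.
move=> hx p; have [q qp hq] := hx 1 ltr01 p.
have [r rq [c' nr]] := near_below x q ltr01.
exists r; first exact: pos_below_trans rq qp.
(* Below [r] both the constant [c'] and the value [c s] approximate [x] within 1, so they differ by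
   at most 2. *)
exists (`|c'| + 2) => s sr.
have nr' : near (sval s) e x c' 1 by apply: near_mono nr.
have := near_unique (pos_elt_ge0 s) e0 (@pos_elt_ndisj s) (hq s (pos_below_trans sr rq)) nr'.
by have := ler_normD (c s - c') c'; rewrite subrK; lra.
Qed.

(** By the Archimedean property some [rpos (x - d *: e)] is nonzero. Below it [x] is at least
    [d *: e], so an approximation within [d / 2] is at least [d / 2]. *)
Lemma represents_pos_lower x c : 0 <=: x -> x <> 0 -> represents x c ->
  exists d p, 0 < d /\ forall q, pos_below q p -> d <= c q.
Proof.
move=> x0 xn0 hx.
have [d d0 nx] : exists2 d : R, 0 < d & rpos (x - d *: e) <> 0.
  apply: contrapT => H; apply: xn0; apply: rs_antisym => //.
  apply: (archimedean_le arch e0) => d d0.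
  have /rpos_eq0_le : rpos (x - d *: e) = 0.
    by apply: contrapT => n; apply: H; exists d.
  by move/rleBl; rewrite add0r.
pose p : pos_elt := exist _ _ (conj (rpos_ge0 (x - d *: e)) nx).
have d2 : 0 < d / 2 by lra.
have [q qp hq] := hx _ d2 p; exists (d / 2), q; split=> // r rq.
have [h _] := hq r rq.
have : leon (sval r) (d *: e) x.
  apply: (@leon_mono _ _ _ (sval p)) => //; first exact: pos_below_trans rq qp.
  by rewrite /leon -[d *: e - x]opprB; apply/disjC/disj_pos_neg.
move=> /leon_trans/(_ h) k.
have := leon_scale_le (pos_elt_ge0 r) e0 (@pos_elt_ndisj r) (k (pos_elt_ge0 r)); lra.
Qed.

End LocalValue.

(** * The pointwise product as a Riesz bimorphism *)

Section PairFunctions.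
Variables (R : realType) (E F : RieszSpace R) (e : E) (f : F).
Hypotheses (archE : archimedean E) (archF : archimedean F)
  (wue : weak_unit e) (wuf : weak_unit f).

Local Notation T := (pos_elt E * pos_elt F)%type.
Definition pair_below (s t : T) := pos_below s.1 t.1 /\ pos_below s.2 t.2.

Lemma pair_belowxx t : pair_below t t.
Proof. by split; apply: pos_belowxx. Qed.

Lemma pair_below_trans s t r : pair_below t s -> pair_below s r -> pair_below t r.
Proof. by move=> [h1 h2] [k1 k2]; split; [exact: pos_below_trans k1|exact: pos_below_trans k2]. Qed.

Lemma ev_fst A : ev (@pos_below R E) A -> ev pair_below (fun t => A t.1).
Proof.
move=> h [p q]; have [p' pp' hp] := h p; exists (p', q).
  by split => //; apply: pos_belowxx.
by move=> [r s] [/= rp _]; apply: hp.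
Qed.

Lemma ev_snd A : ev (@pos_below R F) A -> ev pair_below (fun t => A t.2).
Proof.
move=> h [p q]; have [q' qq' hq] := h q; exists (p, q').
  by split => //; apply: pos_belowxx.
by move=> [r s] [/= _ sq]; apply: hq.
Qed.

Lemma locally_bounded_fst (c : pos_elt E -> R^o) : locally_bounded (@pos_below R E) c ->
  locally_bounded pair_below (fun t => c t.1).
Proof.
move=> h [p q]; have [p' pp' [M hM]] := h p; exists (p', q).
  by split => //; apply: pos_belowxx.
by exists M => -[r s] [/= rp _]; apply: hM.
Qed.

Lemma locally_bounded_snd (c : pos_elt F -> R^o) : locally_bounded (@pos_below R F) c ->
  locally_bounded pair_below (fun t => c t.2).
Proof.
move=> h [p q]; have [q' qq' [M hM]] := h q; exists (p, q').
  by split => //; apply: pos_belowxx.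
by exists M => -[r s] [/= _ sq]; apply: hM.
Qed.

Local Notation pre := (dense_preorder R pair_belowxx pair_below_trans).
Local Notation pi := (@rproj _ _ pre).
Local Notation L := (lb_subspace R pair_belowxx pair_below_trans).
Local Notation G := (rsub_riesz L).

Definition pair_prod (c : pos_elt E -> R) (d : pos_elt F -> R) : T -> R^o :=
  fun t => c t.1 * d t.2.

Lemma pair_prod_bounded x y c d : represents e x c -> represents f y d ->
  locally_bounded pair_below (pair_prod c d).
Proof.
move=> hc hd; apply: locally_boundedM; first exact: pair_below_trans.
  exact: locally_bounded_fst (represents_bounded archE wue hc).
exact: locally_bounded_snd (represents_bounded archF wuf hd).
Qed.

Lemma pair_prod_eq x y c d c' d' : represents e x c -> represents f y d ->
  represents e x c' -> represents f y d' -> pi (pair_prod c d) = pi (pair_prod c' d').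
Proof.
move=> hc hd hc' hd'; apply: dproj_eq => a a0 t.
have [s st [M sM]] := locally_bounded_snd (represents_bounded archF wuf hd) t.
have [r rs [N rN]] := locally_bounded_fst (represents_bounded archE wue hc') s.
(* If each factor is off by at most [b], the product is off by at most [b * (|M| + |N|)]; the
   summand 1 keeps the divisor in [b] positive. *)
have K0 : 0 < 2 * (`|M| + `|N| + 1).
  by have := normr_ge0 M; have := normr_ge0 N; lra.
pose b := a / (2 * (`|M| + `|N| + 1)).
have b0 : 0 < b by apply: divr_gt0.
have ab : a = b * (2 * (`|M| + `|N| + 1)) by rewrite /b divfK// gt_eqF.
have := ev_and pair_below_trans (fun _ h k => conj h k)
  (ev_fst (represents_unique wue hc hc' b0)) (ev_snd (represents_unique wuf hd hd' b0)).
move=> /(_ r)[u ur hu]; exists u; first exact: pair_below_trans ur (pair_below_trans rs st).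
move=> v vu; have [h k] := hu v vu.
have vr := pair_below_trans vu ur.
have {}rN := rN v vr; have {}sM := sM v (pair_below_trans vr rs).
rewrite /pair_prod.
have -> : c v.1 * d v.2 - c' v.1 * d' v.2 =
    (c v.1 - c' v.1) * d v.2 + c' v.1 * (d v.2 - d' v.2) by ring.
apply: le_trans (ler_normD _ _) _; rewrite !normrM.
have h1 : `|c v.1 - c' v.1| * `|d v.2| <= b * `|M|.
  by apply: ler_pM => //; apply: le_trans sM (ler_norm _).
have h2 : `|c' v.1| * `|d v.2 - d' v.2| <= `|N| * b.
  by apply: ler_pM => //; apply: le_trans rN (ler_norm _).
rewrite ab; apply: le_trans (lerD h1 h2) _.
have := normr_ge0 M; have := normr_ge0 N; nra.
Qed.

Lemma pair_tensor_mem x y :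
  L (pi (pair_prod (local_value e x) (local_value f y))).
Proof.
eexists; first by [].
by apply: pair_prod_bounded; apply: local_value_represents.
Qed.

Definition pair_tensor (x : E) (y : F) : G := rsub_mk (pair_tensor_mem x y).

(** Free choice of representatives turns the bimorphism laws into pointwise identities. *)
Lemma rval_pair_tensor x y c d : represents e x c -> represents f y d ->
  rval (pair_tensor x y) = pi (pair_prod c d).
Proof.
move=> hc hd; rewrite rsub_mkK.
by apply: pair_prod_eq hc hd; apply: local_value_represents.
Qed.

Let rE x := local_value_represents archE wue x.
Let rF y := local_value_represents archF wuf y.

Lemma pair_tensorDl x x' y : pair_tensor (x + x') y = pair_tensor x y + pair_tensor x' y.
Proof.
apply: rval_inj; rewrite rvalD (rval_pair_tensor (representsD (rE x) (rE x')) (rF y)).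
rewrite -rprojD; congr (rproj _); apply/funext => t.
by rewrite /pair_prod/= mulrDl.
Qed.

Lemma pair_tensorDr x y y' : pair_tensor x (y + y') = pair_tensor x y + pair_tensor x y'.
Proof.
apply: rval_inj; rewrite rvalD (rval_pair_tensor (rE x) (representsD (rF y) (rF y'))).
rewrite -rprojD; congr (rproj _); apply/funext => t.
by rewrite /pair_prod/= mulrDr.
Qed.

Lemma pair_tensorZl a x y : pair_tensor (a *: x) y = a *: pair_tensor x y.
Proof.
apply: rval_inj; rewrite rvalZ (rval_pair_tensor (representsZ wue a (rE x)) (rF y)).
rewrite -rprojZ; congr (rproj _); apply/funext => t.
by rewrite /pair_prod/= -mulrA.
Qed.

Lemma pair_tensorZr a x y : pair_tensor x (a *: y) = a *: pair_tensor x y.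
Proof.
apply: rval_inj; rewrite rvalZ (rval_pair_tensor (rE x) (representsZ wuf a (rF y))).
rewrite -rprojZ; congr (rproj _); apply/funext => t.
by rewrite /pair_prod/= mulrCA.
Qed.

Lemma max_mulr (c d : R) : 0 <= d -> Num.max c 0 * d = Num.max (c * d) 0.
Proof. by move=> d0; rewrite maxr_pMl// mul0r. Qed.

Lemma pair_tensor_posl x y : 0 <=: y -> pair_tensor (rpos x) y = rpos (pair_tensor x y).
Proof.
(* As [y] is positive, it has a representative that is nonnegative at every point, so multiplying by
   it commutes with the maximum everywhere. *)
move=> y0; have hy := represents_pos wuf (rF y); rewrite (rpos_id y0) in hy.
apply: rval_inj; rewrite rval_pos (rval_pair_tensor (represents_pos wue (rE x)) hy).
rewrite (rval_pair_tensor (rE x) hy) dproj_pos; congr (rproj _); apply/funext => t.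
by rewrite /pair_prod/= max_mulr// le_max lexx orbT.
Qed.

Lemma pair_tensor_posr x y : 0 <=: x -> pair_tensor x (rpos y) = rpos (pair_tensor x y).
Proof.
move=> x0; have hx := represents_pos wue (rE x); rewrite (rpos_id x0) in hx.
apply: rval_inj; rewrite rval_pos (rval_pair_tensor hx (represents_pos wuf (rF y))).
rewrite (rval_pair_tensor hx (rF y)) dproj_pos; congr (rproj _); apply/funext => t.
by rewrite /pair_prod/= mulrC max_mulr ?le_max ?lexx ?orbT// mulrC.
Qed.

Lemma pair_tensor_bimorphism : riesz_bimorphism pair_tensor.
Proof.
split; first move=> x x0.
  apply: riesz_hom_of_rpos => [y y'|a y|y].
  - exact: pair_tensorDr.
  - exact: pair_tensorZr.
  - exact: pair_tensor_posr.
split; first move=> y y0.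
  apply: riesz_hom_of_rpos => [x x'|a x|x].
  - exact: pair_tensorDl.
  - exact: pair_tensorZl.
  - exact: pair_tensor_posl.
by split=> [x|y]; split=> *; rewrite ?(pair_tensorDl, pair_tensorDr, pair_tensorZl, pair_tensorZr).
Qed.

(** Below some [(p, q)] the product is at least [d * d'], whereas a null function is at most
    [d * d' / 2] somewhere below [(p, q)]. *)
Lemma pair_tensor_neq0 x y : 0 <=: x -> x <> 0 -> 0 <=: y -> y <> 0 -> pair_tensor x y <> 0.
Proof.
move=> x0 xn0 y0 yn0 h.
have [d [p [d0 hp]]] := represents_pos_lower archE wue x0 xn0 (rE x).
have [d' [q [d0' hq]]] := represents_pos_lower archF wuf y0 yn0 (rF y).
have : rval (pair_tensor x y) = pi (fun=> 0) by rewrite h rval0 -(rproj0 pre).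
rewrite (rval_pair_tensor (rE x) (rF y)) => /rproj_eq[hle _].
have dd : 0 < d * d' / 2 by rewrite divr_gt0 ?mulr_gt0.
have [s [sp sq] /(_ s (pair_belowxx s))] := hle _ dd (p, q).
have := hp _ sp; have := hq _ sq; rewrite /pair_prod add0r => h1 h2 h3.
have : d * d' <= local_value e x s.1 * local_value f y s.2.
  by apply: ler_pM => //; apply: ltW.
lra.
Qed.

End PairFunctions.

(** The homomorphism factoring [pair_tensor] through [tp] would send [tp x y = 0] to a nonzero
    element. *)
Lemma fremlin_tensor_neq0 (R : realType) (E F H : RieszSpace R) (tp : E -> F -> H)
  (e : E) (f : F) (x : E) (y : F) :
  archimedean E -> archimedean F -> weak_unit e -> weak_unit f -> is_fremlin_tensor tp ->
  0 <=: x -> x <> 0 -> 0 <=: y -> y <> 0 -> tp x y <> 0.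
Proof.
move=> aE aF we wf [_ [_ univ]] x0 xn0 y0 yn0 h.
have [||T [homT [Ttp _]]] := univ _ (pair_tensor aE aF we wf).
- exact: lb_archimedean.
- exact: pair_tensor_bimorphism.
apply: (@pair_tensor_neq0 _ _ _ _ _ aE aF we wf _ _ x0 xn0 y0 yn0).
by rewrite -Ttp h (rhom0 homT).
Qed.

(** * Finite coverings *)

Section Covers.
Variables (R : realType) (V : RieszSpace R).
Implicit Types (x y z w a : V) (s : seq V).

Lemma rmeet_ge0 x y : 0 <=: x -> 0 <=: y -> 0 <=: rmeet x y.
Proof. exact: rle_meet. Qed.

Lemma rmeetD_le x y z : 0 <=: x -> 0 <=: y -> 0 <=: z ->
  rmeet (x + y) z <=: rmeet x z + rmeet y z.
Proof.
move=> x0 y0 z0; rewrite [rmeet x z + _]addrC; apply/rleBl; apply: rle_meet.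
  apply/rleBl; rewrite [y + rmeet x z]addrC; apply/rleBl; apply: rle_meet; apply/rleBl.
    exact: rmeet_lel.
  exact: rle_trans (rmeet_ler _ _) (rle_addr _ _).
apply/rleBl; apply: rle_trans (rmeet_ler _ _) (rle_addr _ _).
exact: rmeet_ge0.
Qed.

Lemma rsum_ge0 s : (forall p, p \in s -> 0 <=: p) -> 0 <=: \sum_(p <- s) p.
Proof.
elim: s => [|p s IH] h; first by rewrite big_nil.
rewrite big_cons; apply: raddr_ge0; first by apply: h; rewrite mem_head.
by apply: IH => q qs; apply: h; rewrite in_cons qs orbT.
Qed.

Lemma rmeet_suml s z : (forall p, p \in s -> 0 <=: p) -> 0 <=: z ->
  rmeet (\sum_(p <- s) p) z <=: \sum_(p <- s) rmeet p z.
Proof.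
move=> + z0; elim: s => [|p s IH] h; first by rewrite !big_nil; exact: rmeet_lel.
have hs q : q \in s -> 0 <=: q by move=> qs; apply: h; rewrite in_cons qs orbT.
rewrite !big_cons; apply: rle_trans (rmeetD_le _ _ z0) _.
- by apply: h; rewrite mem_head.
- exact: rsum_ge0.
- by apply: rleD => //; apply: IH.
Qed.

Lemma rsum_le (I : eqType) (s : seq I) (F G : I -> V) :
  (forall i, i \in s -> F i <=: G i) -> \sum_(i <- s) F i <=: \sum_(i <- s) G i.
Proof.
elim: s => [|i s IH] h; first by rewrite !big_nil.
rewrite !big_cons; apply: rleD; first by apply: h; rewrite mem_head.
by apply: IH => q qs; apply: h; rewrite in_cons qs orbT.
Qed.

Lemma leon_sum s x y : (forall p, p \in s -> 0 <=: p /\ leon p x y) ->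
  leon (\sum_(p <- s) p) x y.
Proof.
elim: s => [|p s IH] h; first by rewrite big_nil; apply: disj0r.
have hs q : q \in s -> 0 <=: q /\ leon q x y.
  by move=> qs; apply: h; rewrite in_cons qs orbT.
have [p0 lp] := h p (mem_head _ _).
rewrite big_cons; apply/disjC/disjD => //; [|exact: disjC|exact/disjC/IH].
by apply: rsum_ge0 => q /hs[].
Qed.

(* Up to a positive factor, the members of [s] form a partition of unity for
   the unit [a]; they are not required to be disjoint. *)
Definition unit_cover a s := (forall p, p \in s -> 0 <=: p /\ p <=: a) /\
  exists2 k : R, 0 < k & k *: a <=: \sum_(p <- s) p.

Lemma unit_cover1 a : 0 <=: a -> unit_cover a [:: a].
Proof.
move=> a0; split=> [p|]; first by rewrite mem_seq1 => /eqP ->.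
by exists 1; rewrite ?ltr01// scale1r big_seq1.
Qed.

(** Meets are subadditive, so the sum of the pairwise meets dominates the meet of the two sums. Only
    positivity is asked of [s'], whose members in [unit_cover_steps] may exceed [a]. *)
Lemma unit_cover_refine a s s' (k : R) : 0 <=: a -> unit_cover a s ->
  (forall p, p \in s' -> 0 <=: p) -> 0 < k -> k *: a <=: \sum_(p <- s') p ->
  unit_cover a [seq rmeet p q | p <- s, q <- s'].
Proof.
move=> a0 [hs [k1 k10 ks]] hs' k0 ks'; split.
  move=> _ /allpairsP[[p q] /= [ps qs ->]]; have [p0 pa] := hs p ps; split.
    by apply: rmeet_ge0 => //; apply: hs'.
  exact: rle_trans (rmeet_lel _ _) pa.
exists (Num.min k1 k); first by rewrite lt_min k10 k0.
have hs0 p : p \in s -> 0 <=: p by move=> /hs[].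
rewrite big_allpairs_dep; apply: (@rle_trans _ _ (rmeet (\sum_(p <- s) p) (\sum_(q <- s') q))).
  apply: rle_meet.
    by apply: rle_trans ks; apply: rscale_le => //; rewrite ge_min lexx.
  by apply: rle_trans ks'; apply: rscale_le => //; rewrite ge_min lexx orbT.
apply: rle_trans (rmeet_suml hs0 (rsum_ge0 hs')) _.
apply: rsum_le => p ps; rewrite rmeetC.
have := rmeet_suml hs' (hs0 p ps); move=> /rle_trans; apply.
by apply: rsum_le => q qs; rewrite rmeetC.
Qed.

(** Provides the bound on the constant that [near_tp] asks of its first factor. *)
Lemma near_clamp m a x (c d : R) : 0 <=: m -> 0 <=: a -> 0 <= d -> - a <=: x -> x <=: a ->
  near m a x c d -> exists2 c', `|c'| <= 1 & near m a x c' d.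
Proof.
move=> m0 a0 d0 ax xa nx.
have [c1|c1] := ltP 1 c.
  exists 1; rewrite ?normr1//; split.
    apply: leon_le => //; apply: rle_trans xa _; rewrite -{1}[a]scale1r.
    by apply: rscale_le => //; rewrite lerDl.
  case: nx => _ h; apply: leon_trans _ h => //.
  by apply/leon_le => //; apply: rscale_le => //; rewrite lerD2r ltW.
have [c2|c2] := ltP c (- 1).
  exists (- 1); rewrite ?normrN1//; split.
    case: nx => h _; apply: leon_trans h _ => //.
    by apply/leon_le => //; apply: rscale_le => //; rewrite lerD2r ltW.
  apply: leon_le => //; apply: rle_trans ax; rewrite -scaleN1r.
  by apply: rscale_le => //; rewrite gerBl.
by exists c => //; rewrite ler_norml c2 c1.
Qed.

(** A sweep upwards from [-1] in steps of [d]. Each unsettled cell is cut by [p1], where [x / a] is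
    confined to an interval of radius [d], and by [p2], where the lower bound rises by [d]. The two
    ranges overlap by [d], so [p1 + p2] dominates [d *: a]. *)
Lemma unit_cover_steps a x (d : R) n : 0 <=: a -> - a <=: x -> x <=: a -> 0 < d ->
  exists2 s, unit_cover a s & forall p, p \in s ->
    leon p ((n%:R * d - 1) *: a) x \/ exists c, near p a x c d.
Proof.
move=> a0 ax xa d0; elim: n => [|n [s cs hs]].
  exists [:: a]; first exact: unit_cover1.
  move=> p; rewrite mem_seq1 => /eqP ->; left; apply: leon_le => //.
  by rewrite mul0r sub0r scaleN1r.
pose p1 := rpos ((n%:R * d - 1 + d + d) *: a - x).
pose p2 := rpos (x - (n%:R * d - 1 + d) *: a).
exists [seq rmeet p q | p <- s, q <- [:: p1; p2]].
  apply: (@unit_cover_refine _ _ _ d) => //.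
    by move=> p; rewrite !inE => /orP[] /eqP ->; apply: rpos_ge0.
  rewrite !big_cons big_nil addr0.
  have -> : d *: a = ((n%:R * d - 1 + d + d) *: a - x) + (x - (n%:R * d - 1 + d) *: a).
    by rewrite addrA subrK -scalerBl; congr (_ *: _); ring.
  exact: rleD.
move=> _ /allpairsP[[p q] /= [ps qs ->]].
have p0 : 0 <=: p by case: cs => h _; case: (h p ps).
have q0 : 0 <=: q by move: qs; rewrite !inE => /orP[] /eqP ->; apply: rpos_ge0.
have r0 := rmeet_ge0 p0 q0.
have rp := rmeet_lel p q; have rq := rmeet_ler p q.
case: (hs p ps) => [h|[c nc]]; last by right; exists c; apply: near_mono nc.
move: qs; rewrite !inE => /orP[] /eqP qE; [right|left].
  exists (n%:R * d - 1 + d); split; last by rewrite addrK; apply: leon_mono h.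
  apply: (disj_mono (rpos_ge0 _) r0 (rle_refl _) rq); rewrite qE /p1.
  by rewrite -[x - _]opprB; apply/disjC/disj_pos_neg.
have -> : n.+1%:R * d - 1 = n%:R * d - 1 + d by rewrite -natr1; ring.
apply: (disj_mono (rpos_ge0 _) r0 (rle_refl _) rq); rewrite qE /p2.
by rewrite -[_ *: a - x]opprB; apply/disjC/disj_pos_neg.
Qed.

Lemma unit_cover_near a x (d : R) : 0 <=: a -> - a <=: x -> x <=: a -> 0 < d ->
  exists2 s, unit_cover a s & forall p, p \in s -> exists2 c, `|c| <= 1 & near p a x c d.
Proof.
move=> a0 ax xa d0; have [n hn] : exists n : nat, 2 / d <= n%:R.
  exists (Num.trunc `|2 / d|).+1; apply: le_trans (ler_norm _) _.
  by rewrite ltW// truncnS_gt.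
rewrite ler_pdivrMr// in hn.
have [s cs hs] := unit_cover_steps n a0 ax xa d0; exists s => // p ps.
have p0 : 0 <=: p by case: cs => h _; case: (h p ps).
suff [c nc] : exists c, near p a x c d by apply: near_clamp nc => //; apply: ltW.
(* On the cells still unsettled, [x] is at least [(n d - 1) a] with [n d - 1 >= 1], and
   [x <=: a]. *)
case: (hs p ps) => // h; exists (n%:R * d - 1); split.
  apply: leon_le => //; apply: rle_trans xa _; rewrite -{1}[a]scale1r.
  by apply: rscale_le => //; lra.
by apply: leon_trans _ h => //; apply: leon_le => //; apply: rscale_le => //; lra.
Qed.

End Covers.

(** * Density of elementary tensors *)

Section Bimorphism.
Variables (R : realType) (E F H : RieszSpace R) (tp : E -> F -> H).
Hypothesis bim : riesz_bimorphism tp.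

Lemma tp_homr x : 0 <=: x -> riesz_hom (tp x).
Proof. by case: bim => h _; apply: h. Qed.
Lemma tp_homl y : 0 <=: y -> riesz_hom (tp^~ y).
Proof. by case: bim => _ [h _]; apply: h. Qed.

Lemma tpDr x y y' : tp x (y + y') = tp x y + tp x y'.
Proof. by case: bim => _ [_ [h _]]; apply: (h x).1. Qed.
Lemma tpZr a x y : tp x (a *: y) = a *: tp x y.
Proof. by case: bim => _ [_ [h _]]; apply: (h x).2. Qed.
Lemma tpDl x x' y : tp (x + x') y = tp x y + tp x' y.
Proof. by case: bim => _ [_ [_ h]]; apply: (h y).1. Qed.
Lemma tpZl a x y : tp (a *: x) y = a *: tp x y.
Proof. by case: bim => _ [_ [_ h]]; apply: (h y).2. Qed.
Lemma tpNl x y : tp (- x) y = - tp x y.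
Proof. by rewrite -scaleN1r tpZl scaleN1r. Qed.
Lemma tpNr x y : tp x (- y) = - tp x y.
Proof. by rewrite -scaleN1r tpZr scaleN1r. Qed.
Lemma tp0l y : tp 0 y = 0.
Proof. by rewrite -(scale0r 0) tpZl scale0r. Qed.
Lemma tp0r x : tp x 0 = 0.
Proof. by rewrite -(scale0r 0) tpZr scale0r. Qed.
Lemma tpBl x x' y : tp (x - x') y = tp x y - tp x' y.
Proof. by rewrite tpDl tpNl. Qed.
Lemma tpBr x y y' : tp x (y - y') = tp x y - tp x y'.
Proof. by rewrite tpDr tpNr. Qed.

Lemma tp_ge0 x y : 0 <=: x -> 0 <=: y -> 0 <=: tp x y.
Proof. by move=> x0; apply: rhom_ge0; apply: tp_homr. Qed.

Lemma tp_le x x' y y' : 0 <=: x -> 0 <=: y -> x <=: x' -> y <=: y' -> tp x y <=: tp x' y'.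
Proof.
move=> x0 y0 xx' yy'; have x'0 := rle_trans x0 xx'.
apply: (@rle_trans _ _ (tp x' y)); first exact: (rhom_le (tp_homl y0)).
exact: (rhom_le (tp_homr x'0)).
Qed.

(** Both tensors are dominated by images under the single homomorphism [tp^~ (y + y')], which
    preserves disjointness. *)
Lemma tp_disjl r p y y' : 0 <=: r -> 0 <=: p -> 0 <=: y -> 0 <=: y' ->
  disj r p -> disj (tp r y) (tp p y').
Proof.
move=> r0 p0 y0 y'0 d; have yy0 : 0 <=: y + y' by apply: raddr_ge0.
apply: (disj_mono (tp_ge0 r0 y0) (tp_ge0 p0 y'0) _ _ (rhom_disj (tp_homl yy0) d)).
  by apply: tp_le => //; apply: rle_addr.
by apply: tp_le => //; rewrite addrC; apply: rle_addr.
Qed.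

Lemma tp_disjr s q x x' : 0 <=: s -> 0 <=: q -> 0 <=: x -> 0 <=: x' ->
  disj s q -> disj (tp x s) (tp x' q).
Proof.
move=> s0 q0 x0 x'0 d; have xx0 : 0 <=: x + x' by apply: raddr_ge0.
apply: (disj_mono (tp_ge0 x0 s0) (tp_ge0 x'0 q0) _ _ (rhom_disj (tp_homr xx0) d)).
  by apply: tp_le => //; apply: rle_addr.
by apply: tp_le => //; rewrite addrC; apply: rle_addr.
Qed.

Lemma leon_tpl p q x x' y : 0 <=: p -> 0 <=: q -> 0 <=: y ->
  leon p x x' -> leon (tp p q) (tp x y) (tp x' y).
Proof.
move=> p0 q0 y0 h; rewrite /leon -tpBl -(rhom_pos (tp_homl y0)).
exact: tp_disjl.
Qed.

Lemma leon_tpr p q x y y' : 0 <=: p -> 0 <=: q -> 0 <=: x ->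
  leon q y y' -> leon (tp p q) (tp x y) (tp x y').
Proof.
move=> p0 q0 x0 h; rewrite /leon -tpBr -(rhom_pos (tp_homr x0)).
exact: tp_disjr.
Qed.

Lemma component_tp e f p q : 0 <=: e -> 0 <=: f -> component e p -> component f q ->
  component (tp e f) (tp p q).
Proof.
move=> e0 f0 /componentP[p0 pe dp] /componentP[q0 qf dq].
have ep0 : 0 <=: e - p by apply/rsub_ge0.
have fq0 : 0 <=: f - q by apply/rsub_ge0.
apply/componentP; split; [exact: tp_ge0|exact: tp_le|].
(* Each summand of the complement is disjoint from [tp p q] through one of the two factors. *)
have -> : tp e f - tp p q = tp (e - p) q + tp e (f - q).
  by rewrite tpBl tpBr [RHS]addrC addrA subrK.
by apply: disjD; [exact: tp_ge0..|exact: tp_disjl|exact: tp_disjr].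
Qed.

(* [2 (a (x) b - x (x) y) = (a - x) (x) (b + y) + (a + x) (x) (b - y)] *)
Lemma leon_tp_dom p q a b x y : 0 <=: p -> 0 <=: q ->
  leon p x a -> leon p (- a) x -> - b <=: y -> y <=: b -> leon (tp p q) (tp x y) (tp a b).
Proof.
move=> p0 q0 xa ax yb by_.
have m0 := tp_ge0 p0 q0.
have b1 : 0 <=: b + y by rewrite -[y]opprK; apply/rsub_ge0/rleN; rewrite opprK.
have b2 : 0 <=: b - y by apply/rsub_ge0.
have h1 := leon_tpl p0 q0 b1 xa.
have h2 := leon_tpl p0 q0 b2 ax.
have := leonZ m0 (_ : 0 <= 2^-1) (leonD m0 h1 h2).
rewrite invr_ge0 ler0n => /(_ isT).
rewrite /leon -!scalerBr.
have -> : tp x (b + y) + tp (- a) (b - y) - (tp a (b + y) + tp x (b - y)) =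
   2 *: (tp x y - tp a b).
  rewrite scaler_nat mulr2n !(tpDr, tpNl, tpNr) !opprD !opprK.
  (* The terms in [tp x b] and [tp a y] cancel in pairs. *)
  by rewrite (AC ((2*2)*(2*2)) ((1*7)*(4*6)*((2*3)*(8*5))))/= !subrr !add0r.
by rewrite scalerA mulVf ?pnatr_eq0// scale1r.
Qed.

(** Write [x (x) y] as [(x - c a) (x) y + c (a (x) y)]. The first term is at most [r (a (x) b)] in
    modulus by [leon_tp_dom], and the second is off by [|c| r <= r]. *)
Lemma near_tp p q a b x y (c d r : R) : 0 <=: p -> 0 <=: q -> 0 <=: a -> 0 <=: b ->
  0 <= r -> `|c| <= 1 -> - b <=: y -> y <=: b -> near p a x c r -> near q b y d r ->
  near (tp p q) (tp a b) (tp x y) (c * d) (r + r).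
Proof.
move=> p0 q0 a0 b0 r0 c1 yb by_ [x1 x2] [y1 y2].
have m0 := tp_ge0 p0 q0; have w0 := tp_ge0 a0 b0.
have n1 : near (tp p q) (tp a b) (tp a y) d r.
  by split; rewrite -tpZr; apply: leon_tpr.
have h1 : leon p (x - c *: a) (r *: a).
  have := leonD p0 x1 (leon_le p0 (rle_refl (- (c *: a)))).
  by rewrite scalerDl [c *: a + _]addrC addrK.
have h2 : leon p (- (r *: a)) (x - c *: a).
  have := leonD p0 x2 (leon_le p0 (rle_refl (- (c *: a)))).
  by rewrite scalerBl [c *: a - _]addrC addrK.
have n2 : near (tp p q) (tp a b) (tp (x - c *: a) y) 0 r.
  split; first by rewrite add0r -tpZl; apply: leon_tp_dom.
  rewrite sub0r scaleNr -tpZl; apply/leonN; rewrite opprK -tpNl.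
  apply: leon_tp_dom => //; last exact/leonN; rewrite -[X in leon _ _ X]opprK.
  exact/leonN.
have := nearD m0 n2 (nearZ c m0 n1).
rewrite add0r -tpZl -tpDl subrK; apply: near_weak => //.
by rewrite lerD2l ler_piMl.
Qed.

(** * Approximation by constants on finite grids *)

Section Grid.
Variables (a : E) (b : F).
Hypotheses (a0 : 0 <=: a) (b0 : 0 <=: b).
Let w := tp a b.

Definition grid (s : seq E) (t : seq F) (h : H) (d : R) :=
  forall p q, p \in s -> q \in t -> exists c, near (tp p q) w h c d.

Definition griddable h := forall d : R, 0 < d ->
  exists s t, [/\ unit_cover a s, unit_cover b t & grid s t h d].

Lemma griddable_tp x y : - a <=: x -> x <=: a -> - b <=: y -> y <=: b -> griddable (tp x y).
Proof.
move=> ax xa yb by_ d d0; have d2 : 0 < d / 2 by lra.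
have [s cs hs] := unit_cover_near a0 ax xa d2.
have [t ct ht] := unit_cover_near b0 yb by_ d2.
exists s, t; split=> // p q ps qt.
have [c c1 nc] := hs p ps; have [c' c'1 nc'] := ht q qt.
exists (c * c'); have -> : d = d / 2 + d / 2 by lra.
apply: near_tp nc nc' => //; last exact: ltW.
  by case: cs => h _; case: (h p ps).
by case: ct => h _; case: (h q qt).
Qed.

Lemma griddable_map h (f : H -> H) (k : R) : 0 < k ->
  (forall m c d, 0 <=: m -> 0 < d -> near m w h c d -> exists c', near m w (f h) c' (k * d)) ->
  griddable h -> griddable (f h).
Proof.
move=> k0 hf gh d d0; have dk : 0 < d / k by apply: divr_gt0.
have [s [t [cs ct g]]] := gh _ dk; exists s, t; split=> // p q ps qt.
have m0 : 0 <=: tp p q.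
  by apply: tp_ge0; [case: cs => i _; case: (i p ps)|case: ct => i _; case: (i q qt)].
have [c nc] := g p q ps qt; have [c' nc'] := hf _ _ _ m0 dk nc.
by exists c'; rewrite mulrC divfK ?gt_eqF// in nc'.
Qed.

(** The two grids have a common refinement, made of pairwise meets in each factor. *)
Lemma griddableD h h' : griddable h -> griddable h' -> griddable (h + h').
Proof.
move=> gh gh' d d0; have d2 : 0 < d / 2 by lra.
have [s [t [cs ct g]]] := gh _ d2; have [s' [t' [cs' ct' g']]] := gh' _ d2.
have [hs _] := cs; have [ht _] := ct; have [hs' [k k0 ks']] := cs'; have [ht' [l l0 lt']] := ct'.
exists [seq rmeet p q | p <- s, q <- s'], [seq rmeet p q | p <- t, q <- t']; split.
- by apply: unit_cover_refine ks' => // p /hs'[].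
- by apply: unit_cover_refine lt' => // p /ht'[].
move=> _ _ /allpairsP[[p p'] /= [ps ps' ->]] /allpairsP[[q q'] /= [qt qt' ->]].
have [p0 _] := hs p ps; have [p'0 _] := hs' p' ps'.
have [q0 _] := ht q qt; have [q'0 _] := ht' q' qt'.
have [c nc] := g p q ps qt; have [c' nc'] := g' p' q' ps' qt'.
have m0 : 0 <=: tp (rmeet p p') (rmeet q q') by apply: tp_ge0; apply: rmeet_ge0.
exists (c + c'); have -> : d = d / 2 + d / 2 by lra.
apply: nearD => //; [apply: near_mono nc|apply: near_mono nc'] => //;
  apply: tp_le; (exact: rmeet_ge0 || exact: rmeet_lel || exact: rmeet_ler).
Qed.

(** Fixing [a] and [b] lets one unit [a (x) b] measure every approximation in a derivation. *)
Inductive gen : H -> Prop :=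
| gen_tp x y : - a <=: x -> x <=: a -> - b <=: y -> y <=: b -> gen (tp x y)
| genD h h' : gen h -> gen h' -> gen (h + h')
| genZ k h : gen h -> gen (k *: h)
| gen_pos h : gen h -> gen (rpos h).

Lemma gen_griddable h : gen h -> griddable h.
Proof.
have w0 : 0 <=: w by apply: tp_ge0.
elim=> [x y|? ? _ ? _ ?|k {}h _|{}h _].
- exact: griddable_tp.
- exact: griddableD.
- apply: (@griddable_map h ( *:%R k) (`|k| + 1)).
    by have := normr_ge0 k; lra.
  move=> m c d m0 d0 nc; exists (k * c); apply: near_weak (nearZ k m0 nc) => //.
  by rewrite mulrDl mul1r lerDl ltW.
- apply: (@griddable_map h (@rpos _ _) 1) => // m c d m0 d0 nc.
  by exists (Num.max c 0); rewrite mul1r; apply: near_pos => //; apply: ltW.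
Qed.

Lemma tp_dom x y : - a <=: x -> x <=: a -> - b <=: y -> y <=: b -> tp x y <=: 2 *: w.
Proof.
(* The factor 2 comes from bounding the contributions of [rpos x] and [rpos (- x)] by [w]
   separately. *)
move=> ax xa yb by_; rewrite -(rpos_sub x) tpBl scaler_nat mulr2n -tpNr.
have xpa : rpos x <=: a by apply: rpos_le.
have xna : rpos (- x) <=: a by apply: rpos_le => //; apply/rleN; rewrite opprK.
have ynb : - y <=: b by apply/rleN; rewrite opprK.
apply: rleD.
  apply: (@rle_trans _ _ (tp (rpos x) b)); last exact: tp_le.
  exact: (rhom_le (tp_homr (rpos_ge0 x))).
apply: (@rle_trans _ _ (tp (rpos (- x)) b)); last exact: tp_le.
exact: (rhom_le (tp_homr (rpos_ge0 (- x)))).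
Qed.

Lemma gen_bounded h : gen h -> exists2 C : R, 0 <= C & h <=: C *: w /\ - h <=: C *: w.
Proof.
have w0 : 0 <=: w by apply: tp_ge0.
elim=> [x y ax xa yb by_|{}h h' _ [C C0 [h1 h2]] _ [C' C'0 [h3 h4]]|k {}h _ [C C0 [h1 h2]]|{}h _ [C C0 [h1 h2]]].
- exists 2 => //; split; first exact: tp_dom.
  rewrite -tpNl; apply: tp_dom => //; first exact/rleN.
  by apply/rleN; rewrite opprK.
- exists (C + C'); first exact: addr_ge0.
  by rewrite opprD !scalerDl; split; apply: rleD.
- exists (`|k| * C); first exact: mulr_ge0.
  have [k0|k0] := leP 0 k.
    by rewrite -!scalerA ger0_norm// -scalerN; split; apply: rs_scale.
  have nk : 0 <= - k by rewrite oppr_ge0 ltW.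
  rewrite -!scalerA ltr0_norm//; split; last by rewrite -scaleNr; apply: rs_scale.
  by rewrite -[k *: h]opprK -scaleNr -scalerN; apply: rs_scale.
- exists C => //; have Cw : 0 <=: C *: w by apply: rscale_ge0.
  split; first exact: rpos_le.
  by apply: rle_trans Cw; apply/rleN; rewrite oppr0 opprK.
Qed.

Lemma gen_density h : archimedean H -> gen h -> 0 <=: h -> h <> 0 ->
  exists p q, [/\ 0 <=: p, 0 <=: q, tp p q <> 0 & exists2 d : R, 0 < d & d *: tp p q <=: h].
Proof.
have w0 : 0 <=: w by apply: tp_ge0.
move=> arch gh h0 hn0; apply: contrapT => no; apply: hn0; apply: rs_antisym => //.
apply: (archimedean_le arch w0) => d d0; have d2 : 0 < d / 2 by lra.
have [s [t [cs ct g]]] := gen_griddable gh d2.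
have [hs [k k0 ks]] := cs; have [ht [l l0 lt]] := ct.
have [C C0 [hC _]] := gen_bounded gh.
(* [r] is shown disjoint from every cell, hence from [w]; as it is below a multiple of [w], it is
   then disjoint from itself. *)
pose r := rpos (h - d *: w).
have rw : disj r w.
  have kl0 : 0 < k * l by apply: mulr_gt0.
  have S0 : 0 <=: \sum_(p <- s) p by apply: rsum_ge0 => p /hs[].
  have T0 : 0 <=: \sum_(q <- t) q by apply: rsum_ge0 => q /ht[].
  (* The cells of the grid add up to the tensor of the two sums, which dominates [(k * l) *: w]. *)
  have kw : w <=: (k * l)^-1 *: tp (\sum_(p <- s) p) (\sum_(q <- t) q).
    apply/(@rscale_leP _ _ (k * l)) => //; rewrite scalerA mulfV ?gt_eqF// scale1r.
    rewrite -scalerA -tpZr -tpZl; apply: tp_le => //; by apply: rscale_ge0 => //; apply: ltW.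
  apply: (disj_mono (rpos_ge0 _) w0 (rle_refl r) kw).
  apply/disjC/disjZ => //; [by rewrite invr_ge0 ltW|exact: tp_ge0|exact: rpos_ge0|apply: disjC].
  have -> : tp (\sum_(p <- s) p) (\sum_(q <- t) q) =
      \sum_(m <- [seq tp p q | p <- s, q <- t]) m.
    rewrite big_allpairs_dep (big_morph (tp^~ _) (fun x y => tpDl x y _) (tp0l _)).
    by apply: eq_bigr => p _; rewrite (big_morph (tp p) (tpDr p) (tp0r p)).
  apply: leon_sum => _ /allpairsP[[p q] /= [ps qt ->]].
  have [p0 pa] := hs p ps; have [q0 qb] := ht q qt.
  have m0 := tp_ge0 p0 q0; split=> //.
  have [c [n1 n2]] := g p q ps qt.
  (* A small constant gives [h] at most [d *: w] on the cell. A large one gives [h] at least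
     [(c - d / 2) *: w] there, and a nonzero cell would then contradict [no]. *)
  have [cd|cd] := leP c (d / 2).
    by apply: leon_trans n1 _ => //; apply/leon_le => //; apply: rscale_le => //; lra.
  have [->|mn0] := eqVneq (tp p q) 0; first exact: disj0r.
  exfalso; apply: no; exists p, q; split=> //; first exact/eqP.
  have cd0 : 0 < c - d / 2 by lra.
  exists (c - d / 2) => //; apply: (disj_le_add _ h0 (rpos_ge0 ((c - d / 2) *: w - h))).
  - by apply: rscale_ge0 => //; apply: ltW.
  - by apply: disjZ => //; [exact: ltW|exact: disjC].
  apply: (@rle_trans _ _ ((c - d / 2) *: w)).
    by apply: rs_scale; [exact: ltW|exact: tp_le].
  by rewrite [h + _]addrC; apply/rleBl; apply: rle_rpos.
have Cw0 : 0 <=: C *: w by apply: rscale_ge0.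
have rC : r <=: C *: w.
  apply: rpos_le => //; apply: rle_trans hC; apply/rleBl/rle_addr.
  by apply: rscale_ge0 => //; apply: ltW.
have : disj r r.
  apply: (disj_mono (rpos_ge0 _) (rpos_ge0 _) (rle_refl r) rC).
  by apply/disjC/disjZ => //; [exact: rpos_ge0|exact: disjC].
by move=> /disjxx/(_ (rpos_ge0 _))/rpos_eq0_le/rleBl; rewrite add0r.
Qed.

End Grid.

Lemma gen_mono a b a' b' h : a <=: a' -> b <=: b' -> gen a b h -> gen a' b' h.
Proof.
move=> aa bb; elim=> [x y ax xa yb by_|? ? _ + _|k {}h _|{}h _].
- apply: gen_tp; [|exact: rle_trans aa| |exact: rle_trans bb].
    by apply: rle_trans ax; apply/rleN.
  by apply: rle_trans yb; apply/rleN.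
- exact: genD.
- exact: genZ.
- exact: gen_pos.
Qed.

Definition generated : riesz_subspace H.
Proof.
exists (fun h => exists a b, [/\ 0 <=: a, 0 <=: b & gen a b h]).
- exists 0, 0; split=> //; rewrite -(tp0l 0); apply: gen_tp; by rewrite ?oppr0.
- move=> h h' [a [b [a0 b0 gh]]] [a' [b' [a'0 b'0 gh']]].
  exists (a + a'), (b + b'); split; [exact: raddr_ge0..|].
  apply: genD.
    by apply: gen_mono gh; apply: rle_addr.
  by apply: gen_mono gh'; rewrite addrC; apply: rle_addr.
- by move=> k h [a [b [a0 b0 gh]]]; exists a, b; split=> //; apply: genZ.
- by move=> h [a [b [a0 b0 gh]]]; exists a, b; split=> //; apply: gen_pos.
Defined.

Lemma generated_tp x y : generated (tp x y).
Proof.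
pose r (V : RieszSpace R) (z : V) := rpos z + rpos (- z).
have zr (V : RieszSpace R) (z : V) : z <=: r V z.
  by apply: rle_trans (rle_rpos z) _; apply: rle_addr.
have rz (V : RieszSpace R) (z : V) : - r V z <=: z.
  apply/rleN; rewrite opprK; apply: rle_trans (rle_rpos _) _.
  by rewrite /r addrC; apply: rle_addr.
by exists (r E x), (r F y); split; [exact: raddr_ge0..|exact: gen_tp].
Qed.

End Bimorphism.

(* The Riesz subspace generated by the elementary tensors inherits a
   bimorphism, and uniqueness in the universal property makes it all of [H]. *)
Lemma fremlin_generated (R : realType) (E F H : RieszSpace R) (tp : E -> F -> H)
  (fr : is_fremlin_tensor tp) h : generated fr.2.1 h.
Proof.
have [arch [bim univ]] := fr.
set S := generated _.
pose tp' x y : rsub_riesz S := rsub_mk (generated_tp fr.2.1 x y).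
have Dl y x x' : tp' (x + x') y = tp' x y + tp' x' y.
  by apply: rval_inj; rewrite rvalD !rsub_mkK (tpDl bim).
have Zl y a x : tp' (a *: x) y = a *: tp' x y.
  by apply: rval_inj; rewrite rvalZ !rsub_mkK (tpZl bim).
have Dr x y y' : tp' x (y + y') = tp' x y + tp' x y'.
  by apply: rval_inj; rewrite rvalD !rsub_mkK (tpDr bim).
have Zr x a y : tp' x (a *: y) = a *: tp' x y.
  by apply: rval_inj; rewrite rvalZ !rsub_mkK (tpZr bim).
have bim' : riesz_bimorphism tp'.
  split; first move=> x x0.
    apply: riesz_hom_of_rpos => [y y'|a y|y]; [exact: Dr|exact: Zr|].
    by apply: rval_inj; rewrite rval_pos !rsub_mkK (rhom_pos (tp_homr bim x0)).
  split; first move=> y y0.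
    apply: riesz_hom_of_rpos => [x x'|a x|x]; [exact: Dl|exact: Zl|].
    by apply: rval_inj; rewrite rval_pos !rsub_mkK (rhom_pos (tp_homl bim y0)).
  by split=> [x|y]; split=> *; rewrite ?(Dl, Dr, Zl, Zr).
have [T [homT [Ttp _]]] := univ _ tp' (rsub_archimedean arch) bim'.
have [T0 [_ [_ uniq]]] := univ _ tp arch bim.
have -> : h = rval (T h); last exact: rvalP.
transitivity (T0 h); first by apply: (uniq id).
apply/esym/(uniq (fun h => rval (T h))) => [|x y]; last by rewrite Ttp.
apply: riesz_hom_of_rpos => [x y|a x|x].
- by rewrite (rhomD homT) rvalD.
- by rewrite (rhomZ homT) rvalZ.
- by rewrite (rhom_pos homT) rval_pos.
Qed.

Lemma fremlin_density (R : realType) (E F H : RieszSpace R) (tp : E -> F -> H) h :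
  is_fremlin_tensor tp -> 0 <=: h -> h <> 0 ->
  exists p q, [/\ 0 <=: p, 0 <=: q, tp p q <> 0 & exists2 d : R, 0 < d & d *: tp p q <=: h].
Proof.
move=> fr h0 hn0; have [a [b [a0 b0 gh]]] := fremlin_generated fr h.
by apply: gen_density gh _ _; case: fr => // _ [].
Qed.

(** * Components *)

Lemma component0 (R : realType) (V : RieszSpace R) (w : V) : 0 <=: w -> component w 0.
Proof. by move=> w0; apply/componentP; split=> //; apply: disj0r; rewrite subr0. Qed.

(* The component is the projection of [e] onto the band generated by
   [(x - d e)^+]. *)
Lemma component_below (R : realType) (E : RieszSpace R) (e x : E) :
  dedekind_complete E -> weak_unit e -> 0 <=: x -> x <> 0 ->
  exists2 p, component e p /\ p <> 0 & exists2 d : R, 0 < d & d *: p <=: x.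
Proof.
move=> dc wue x0 xn0; have arch := dedekind_archimedean dc.
have e0 : 0 <=: e by case: wue.
have [d d0 zn0] : exists2 d : R, 0 < d & rpos (x - d *: e) <> 0.
  apply: contrapT => no; apply: xn0; apply: rs_antisym => //.
  apply: (archimedean_le arch e0) => d d0.
  have /rpos_eq0_le/rleBl : rpos (x - d *: e) = 0.
    by apply: contrapT => n; apply: no; exists d.
  by rewrite add0r.
set z := rpos _ in zn0; have z0 : 0 <=: z by apply: rpos_ge0.
have zn n : 0 <=: z *+ n by rewrite -scaler_nat; apply: rscale_ge0.
have [||p [ub lub]] := dc (fun y => exists n, y = rmeet e (z *+ n)).
- by exists (rmeet e (z *+ 0)), 0%N.
- by exists e => _ [n ->]; apply: rmeet_lel.
have sp n : rmeet e (z *+ n) <=: p by apply: ub; exists n.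
have pe : p <=: e by apply: lub => _ [n ->]; apply: rmeet_lel.
have p0 : 0 <=: p by apply: rle_trans (sp 0%N); apply: rmeet_ge0.
have ep0 : 0 <=: e - p by apply/rsub_ge0.
have dz : disj (e - p) z.
  have r0 : 0 <=: rmeet (e - p) z by apply: rmeet_ge0.
  apply: rs_antisym => //.
  (* Adding the meet of [e - p] and [z] to the [n]-th member of the family stays below the next
     member, so [p] minus that meet is still an upper bound. *)
  apply/(rle_subr p).
  apply: lub => _ [n ->]; apply/rleBr; apply: rle_trans (sp n.+1).
  apply: rle_meet; last first.
    by rewrite mulrSr; apply: rleD; [exact: rmeet_ler|exact: rmeet_ler].
  apply: (@rle_trans _ _ (p + (e - p))); last by rewrite addrC subrK.
  by apply: rleD => //; apply: rmeet_lel.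
have ds n y : 0 <=: y -> disj y z -> disj y (rmeet e (z *+ n)).
  move=> y0 yz; apply: (@disj_mono _ _ _ y _ (z *+ n)) => //.
  - exact: rmeet_ge0.
  - exact: rmeet_ler.
  by rewrite -scaler_nat; apply/disjC/disjZ => //; apply: disjC.
exists p; first split.
- apply/componentP; split=> //; apply/disjP => // r rep rp.
  apply: rle_trans (rle_rpos r) _.
  (* [rpos r] is below [e - p], hence disjoint from each member of the family, so it can be
     subtracted from [p] without losing an upper bound. *)
  apply/(rle_subr p).
  apply: lub => _ [n ->]; apply/rleBr.
  have rp' : rpos r <=: p by apply: rpos_le.
  have rep' : rpos r <=: e - p by apply: rpos_le.
  have d1 : disj (rmeet e (z *+ n)) (rpos r).
    apply/disjC; apply: (disj_mono (rpos_ge0 r) _ rep' (rle_refl _)) (ds n _ ep0 dz).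
    exact: rmeet_ge0.
  suff : rpos r <=: p - rmeet e (z *+ n) by rewrite rleBr addrC.
  apply: (@disj_le_add _ _ _ _ (rmeet e (z *+ n))) => //; [|exact: rmeet_ge0|exact: disjC|by rewrite subrK].
  exact/rsub_ge0.
- move=> pz; apply: zn0; apply: (weak_unit_disj wue z0).
  apply/disjP => // y ye yz; rewrite -pz; apply: rle_trans (sp 1%N).
  by apply: rle_meet.
(* Each member of the family is disjoint from the negative part of [x - d *: e], and [d *: e] is at
   most [x] plus that part. *)
exists d => //; apply/(@rscale_leP _ _ d^-1); first by rewrite invr_gt0.
rewrite scalerA mulVf ?gt_eqF// scale1r; apply: lub => _ [n ->].
apply/(@rscale_leP _ _ d) => //; rewrite scalerA mulfV ?gt_eqF// scale1r.
have s0 : 0 <=: rmeet e (z *+ n) by apply: rmeet_ge0.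
apply: (@disj_le_add _ _ _ _ (rpos (d *: e - x))) => //.
- by apply: rscale_ge0 => //; apply: ltW.
- apply: disjZ => //; first exact: ltW.
  apply/disjC/ds => //; rewrite /z -[x - _]opprB; exact: disj_pos_neg.
apply: (@rle_trans _ _ (d *: e)).
  by apply: rs_scale; [exact: ltW|exact: rmeet_lel].
by rewrite addrC; apply/rleBl/rle_rpos.
Qed.

(** [g] is the supremum of the [j h] below it. If no nonzero positive [h] occurred, every such [h]
    would have zero positive part, and [0] would be an upper bound. *)
Lemma completion_density (R : realType) (H G : RieszSpace R) (j : H -> G) g :
  is_dedekind_completion j -> 0 <=: g -> g <> 0 ->
  exists h, [/\ 0 <=: h, h <> 0 & j h <=: g].
Proof.
move=> [_ [homj [_ /(_ g)[[ub lub] _]]]] g0 gn0.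
apply: contrapT => no; apply: gn0; apply: rs_antisym => //; apply: lub => _ [h [-> hg]].
have h0 : rpos h = 0.
  apply: contrapT => hn0; apply: no; exists (rpos h); split=> //.
  by rewrite (rhom_pos homj); apply: rpos_le.
by rewrite -(rhom0 homj); apply: (rhom_le homj); apply: rpos_eq0_le.
Qed.

Theorem theorem3p1 (R : realType) (E F H G : RieszSpace R)
  (tp : E -> F -> H) (j : H -> G) (e : E) (f : F) :
  dedekind_complete E -> dedekind_complete F ->
  weak_unit e -> weak_unit f ->
  is_fremlin_tensor tp -> is_dedekind_completion j ->
  (forall (p : E) (q : F), component e p -> component f q ->
     component (j (tp e f)) (j (tp p q))) /\
  (forall u : G, component (j (tp e f)) u ->
     is_sup (@rs_le R G)
       (fun z => exists (p : E) (q : F),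
          [/\ component e p, component f q, rs_le (j (tp p q)) u & z = j (tp p q)])
       u).
Proof.
move=> dcE dcF wue wuf fr dcj; have [archH [bim _]] := fr; have [dcG [homj [injj _]]] := dcj.
have e0 : 0 <=: e by case: wue.
have f0 : 0 <=: f by case: wuf.
have partA (p : E) (q : F) : component e p -> component f q ->
    component (j (tp e f)) (j (tp p q)).
  move=> cp cq; have /componentP[h1 h2 h3] := component_tp bim e0 f0 cp cq.
  apply/componentP; split; [exact: (rhom_ge0 homj)|exact: (rhom_le homj)|].
  by rewrite -(rhomB homj); apply: (rhom_disj homj).
split=> // u /componentP[u0 uw du]; set w := j _ in uw du *.
have wu0 : 0 <=: w - u by apply/rsub_ge0.
set S := (X in is_sup _ X).
have ubu : upper_bound (@rs_le R G) S u by move=> _ [p [q [_ _ h ->]]].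
split=> // v ubv.
(* The gap between [u] and the meet [s] of [u] and [v] is disjoint from
   every elementary component below [u]. *)
pose s := rmeet u v; suff us : u - s = 0.
  by rewrite -[u](subrK s) us add0r; apply: rmeet_ler.
have us0 : 0 <=: u - s by apply/rsub_ge0/rmeet_lel.
apply: contrapT => usn0.
have [h [h0 hn0 hus]] := completion_density dcj us0 usn0.
have [x [y [x0 y0 txy [d d0 dh]]]] := fremlin_density fr h0 hn0.
have xn0 : x <> 0 by move=> xE; apply: txy; rewrite xE (tp0l bim).
have yn0 : y <> 0 by move=> yE; apply: txy; rewrite yE (tp0r bim).
have [p [cp pn0] [a a0 ax]] := component_below dcE wue x0 xn0.
have [q [cq qn0] [b b0 by_]] := component_below dcF wuf y0 yn0.
have [p0 pe _] := (componentP e p).1 cp; have [q0 qf _] := (componentP f q).1 cq.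
have m0 : 0 <=: j (tp p q) by apply/(rhom_ge0 homj)/(tp_ge0 bim).
have [k k0 kus] : exists2 k : R, 0 < k & k *: j (tp p q) <=: u - s.
  exists (d * (a * b)); first by rewrite !mulr_gt0.
  apply: rle_trans hus; rewrite -(rhomZ homj); apply: (rhom_le homj).
  apply: rle_trans dh; rewrite -scalerA; apply: rs_scale; first exact: ltW.
  rewrite -scalerA -(tpZr bim) -(tpZl bim).
  by apply: (tp_le bim) => //; apply: rscale_ge0 => //; apply: ltW.
have mk : j (tp p q) <=: k^-1 *: (u - s).
  by apply/(@rscale_leP _ _ k) => //; rewrite scalerA mulfV ?gt_eqF// scale1r.
have ki0 : 0 <= k^-1 by rewrite invr_ge0 ltW.
have /componentP[_ mw dm] := partA p q cp cq.
have s0 : 0 <=: s.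
  (* The family contains [0] as the tensor of the zero components, so [v] is positive. *)
  apply: rmeet_ge0 => //; apply: ubv; exists 0, 0.
  by rewrite (tp0l bim) (rhom0 homj); split=> //; apply: component0.
have mu : j (tp p q) <=: u.
  (* [j (tp p q)] is below a multiple of [u - s <=: u], hence disjoint from [w - u]; being below
     [w = u + (w - u)], it is below [u]. *)
  apply: (@disj_le_add _ _ _ _ (w - u)) => //; last by rewrite addrC subrK.
  have usu : u - s <=: u by apply/rleBl/rle_addr.
  apply: disjC; apply: (disj_mono wu0 m0 (rle_refl _) mk).
  apply/disjC/disjZ => //.
  by apply: (disj_mono us0 wu0 usu (rle_refl _)); apply: disjC.
have ms : j (tp p q) <=: s.
  by apply: rle_meet => //; apply: ubv; exists p, q.
(* As [j (tp p q) <=: s], the gap [u - s] is below the complement [w - j (tp p q)], while a multiple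
   of it dominates [j (tp p q)]. *)
have : disj (j (tp p q)) (j (tp p q)).
  apply: (disj_mono m0 m0 mk (rle_refl _)); apply: disjZ => //.
  apply: (disj_mono us0 m0 _ (rle_refl _)) dm.
  by apply: rleD => //; apply/rleN.
move=> /disjxx/(_ m0); rewrite -(rhom0 homj) => /injj.
apply: (fremlin_tensor_neq0 _ _ wue wuf fr p0 pn0 q0 qn0); exact: dedekind_archimedean.
Qed.
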